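(* Let $X$ be an infinite dimensional complex Banach space and $T\in L(X)$. Then $T$ is quasi B-Fredholm if and only if $T$ is B-Fredholm. Moreover, if this is the case then the index of $T$ as a quasi B-Fredholm operator coincides with its usual index $\mathrm{ind}(T)=\alpha(T_{[m_T]})-\beta(T_{[m_T]})$ as a B-Fredholm operator.
   Context: $L(X)$ is the algebra of bounded linear operators on $X$; $\mathbb N\ni0$. $\alpha(S)=\dim\mathcal N(S)$ is the dimension of the kernel and $\beta(S)$ the codimension of the range $\mathcal R(S)$ of an operator $S$. For a $T$-invariant subspace $M$, $T_M$ is the restriction of $T$ to $M$. $(M,N)\in Red(T)$ means that $M,N$ are closed $T$-invariant subspaces with $X=M\oplus N$. $T_{[n]}:\mathcal R(T^n)\to\mathcal R(T^n)$ is the restriction of $T$ to $\mathcal R(T^n)$. Put $a_e(T)=\inf\{n:\alpha(T_{[n]})<\infty\}$, $d_e(T)=\inf\{n:\beta(T_{[n]})<\infty\}$, $m_T=\inf\{n:\min\{\alpha(T_{[n]}),\beta(T_{[n]})\}<\infty\}$, with $\inf\emptyset=\infty$. $T$ is upper semi-B-Fredholm if $a_e(T)<\infty$ and $\mathcal R(T^{a_e(T)+1})$ is closed; lower semi-B-Fredholm if $d_e(T)<\infty$ and $\mathcal R(T^{d_e(T)})$ is closed; B-Fredholm if it is both. An operator is upper semi-Fredholm if it has closed range and finite dimensional kernel, lower semi-Fredholm if its range has finite codimension (hence is closed), semi-Fredholm if it is one of the two; its index is $\alpha-\beta$. $T$ is quasi upper (resp. quasi lower) semi-B-Fredholm if there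 exists $(M,N)\in Red(T)$ such that $T_M$ is upper (resp. lower) semi-Fredholm and $T_N$ is nilpotent; $T$ is quasi B-Fredholm if it is both quasi upper and quasi lower semi-B-Fredholm (possibly with different pairs). An operator is Drazin invertible if it is a direct sum of an invertible operator and a nilpotent operator; $S$ is meromorphic if $S-\lambda I$ is Drazin invertible for every $\lambda\in\mathbb C\setminus\{0\}$ (e.g. nilpotent operators). If $T$ admits $(M,N)\in Red(T)$ with $T_M$ semi-Fredholm and $T_N$ meromorphic, then the index of $T$ in the generalized sense is $\mathrm{ind}(T_M)$; it does not depend on the choice of such a pair $(M,N)$. The index of $T$ as a quasi B-Fredholm operator is this generalized index. *)

(* Defs.v *)
From mathcomp Require Import all_boot all_order all_algebra.
From mathcomp Require Import complex.
From mathcomp Require Import all_classical all_reals all_analysis.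

Set Implicit Arguments.
Unset Strict Implicit.
Unset Printing Implicit Defensive.

Import Order.TTheory GRing.Theory Num.Theory.
Import numFieldNormedType.Exports.

Local Open Scope classical_set_scope.
Local Open Scope ring_scope.

(* The infimum of a set of natural numbers in [nat] extended by an infinite
   element; [None] is infinity, the infimum of the empty set. *)
Definition inf_nat (A : set nat) : option nat :=
  if pselect (exists n, `[< A n >]) is left ex then Some (ex_minn ex) else None.

Section Operators.
Context {R : realType} {X : completeNormedModType R[i]}.
(* The operator obtained by restricting [S] to an invariant subspace [Y] is
   represented by the pair [S], [Y]; a subspace which is closed in a closed
   subspace [Y] is the same as one contained in [Y] and closed in [X]. *)
Implicit Types (S T : X -> X) (U V Y M N P Q : set X).

Definition lin_subspace Y := GRing.submod_closed (mem Y).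

Definition basis_mod U V n (e : 'I_n -> X) :=
  (forall j, U (e j)) /\
  (forall x, U x -> exists! c : 'I_n -> R[i], V (x - \sum_j c j *: e j)).

(* The dimension of U / V, for subspaces V of U. *)
Definition dim_quo U V : \bar int :=
  if inf_nat [set n | exists e : 'I_n -> X, basis_mod U V e] is Some n
  then (n%:Z)%:E else +oo%E.

Definition alpha S Y := dim_quo (Y `&` S @^-1` [set 0]) [set 0].
Definition beta S Y := dim_quo Y (S @` Y).

(* Used only if [alpha S Y] or [beta S Y] is finite. *)
Definition ind S Y : \bar int := (alpha S Y - beta S Y)%E.

Definition invariant S Y := forall x, Y x -> Y (S x).

Definition Red S Y M N :=
  [/\ lin_subspace M /\ closed M, lin_subspace N /\ closed N,
      invariant S M, invariant S N &
      Y = [set x + y | x in M & y in N] /\ M `&` N = [set 0]].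

Definition upper_semi_Fredholm S Y :=
  closed (S @` Y) /\ (alpha S Y < +oo)%E.

Definition lower_semi_Fredholm S Y := (beta S Y < +oo)%E.

Definition semi_Fredholm S Y :=
  upper_semi_Fredholm S Y \/ lower_semi_Fredholm S Y.

Definition nilpotent S Y := exists k, forall x, Y x -> iter k S x = 0.

Definition invertible S Y :=
  exists g : X -> X, [/\ {within Y, continuous g}, invariant g Y,
    (forall x, Y x -> g (S x) = x) & (forall x, Y x -> S (g x) = x)].

Definition Drazin_invertible S Y :=
  exists P Q, [/\ Red S Y P Q, invertible S P & nilpotent S Q].

Definition meromorphic S Y :=
  forall l : R[i], l != 0 -> Drazin_invertible (fun x => S x - l *: x) Y.

Definition range_pow T n : set X := range (iter n T).

Definition a_e T := inf_nat [set n | (alpha T (range_pow T n) < +oo)%E].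
Definition d_e T := inf_nat [set n | (beta T (range_pow T n) < +oo)%E].
Definition m_ T := inf_nat [set n |
  (Order.min (alpha T (range_pow T n)) (beta T (range_pow T n)) < +oo)%E].

Definition upper_semi_B_Fredholm T :=
  if a_e T is Some n then closed (range_pow T n.+1) else False.

Definition lower_semi_B_Fredholm T :=
  if d_e T is Some n then closed (range_pow T n) else False.

Definition B_Fredholm T := upper_semi_B_Fredholm T /\ lower_semi_B_Fredholm T.

(* The value 0 is a dummy: m_T is finite as soon as a_e(T) or d_e(T) is. *)
Definition B_Fredholm_index T : \bar int :=
  if m_ T is Some n then ind T (range_pow T n) else 0%E.

Definition quasi_upper_semi_B_Fredholm T :=
  exists M N, [/\ Red T setT M N, upper_semi_Fredholm T M & nilpotent T N].

Definition quasi_lower_semi_B_Fredholm T :=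
  exists M N, [/\ Red T setT M N, lower_semi_Fredholm T M & nilpotent T N].

Definition quasi_B_Fredholm T :=
  quasi_upper_semi_B_Fredholm T /\ quasi_lower_semi_B_Fredholm T.

(* The index of [T] restricted to [M], for an arbitrarily chosen pair (M, N) as
   below; the value 0 is a dummy, used only if there is no such pair. *)
Definition generalized_index T : \bar int :=
  xget 0%E [set i | exists M N, [/\ Red T setT M N, semi_Fredholm T M,
                                  meromorphic T N & i = ind T M]].

Definition infinite_dimensional := dim_quo [set: X] [set 0] = +oo%E.

End Operators.

Arguments infinite_dimensional {R} X.

(* Main.v *)
Require Import Defs.
From HB Require Import structures.
From mathcomp Require Import all_boot all_order all_algebra.
From mathcomp Require Import complex.
From mathcomp Require Import all_classical all_reals all_analysis.
From mathcomp Require Import ring lra zify.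
Set Implicit Arguments.
Unset Strict Implicit.
Unset Printing Implicit Defensive.
Import Order.TTheory GRing.Theory Num.Theory.
Import numFieldNormedType.Exports Defs.
Local Open Scope classical_set_scope.
Local Open Scope ring_scope.

(** Write [R_n] for the range of [T ^ n] and [K] for the kernel of [T].

    Algebra.  When an invariant subspace [M] is replaced by [T M], the kernel and
    the cokernel of [T] on it lose the same dimension, that of
    [(M `&` K) / (T M `&` K)] (lemma [has_index_image]).  So if [K `&` R_j] and
    [R_k / R_(k+1)] are finite dimensional for some [j] and [k], then these two
    conditions hold for the same [n], where the index of [T] on [R_n] does not
    depend on [n]; the numbers [a_e], [d_e] and [m_T] coincide.

    From quasi B-Fredholm to B-Fredholm.  If [T] is nilpotent on [N], then
    [R_n = T ^ n M] for large [n], and finiteness of the kernel or of the cokernel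
    passes from [M] to [R_n].  If the cokernel of [T] on [R_n] is finite
    dimensional, then so is [T ^ n N] ([fin_nilpotent]), while [T ^ n M] is closed
    because a range of finite codimension is closed ([closed_image]); hence [R_n],
    a finite dimensional extension of [T ^ n M], is closed.

    From B-Fredholm to quasi B-Fredholm ([fredholm_nilpotent_splitting]).  The
    decreasing finite dimensional spaces [K `&` R_n] are constant from some [d] on.
    Then every vector of [R_d] killed by a power of [T] is in all the [R_m], and
    every vector killed by a power of [T] is in [L = R(T) + N(T ^ d)].  Let [p] be
    a continuous projection on [K `&` R_d] and [G] a finite dimensional complement
    of [L].  The summands are
      [N = { x in N(T ^ d) | p (T ^ k x) = 0 for all k }] and
      [M = G + T G + ... + T ^ (d - 1) G + R_d].
    In terms of modules over [C[t] / t ^ d], [N] is a complement of the free, hence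
    injective, submodule [N(T ^ d) `&` R_d] of [N(T ^ d)], and [M] comes from lifting
    the free, hence projective, quotient [X / (R_d + N(T ^ d))] of [X / R_d].

    Index.  Let [T] be semi-Fredholm on [M] and meromorphic on [N].  For the common
    value [n] of [a_e], [d_e] and [m_T], the space [R_n] is the direct sum of
    [T ^ n M], on which the index is that of [T] on [M], and of the closed subspace
    [T ^ n N], on which [T] is Fredholm.  There the index of [T] is that of
    [T - l] for a small nonzero [l], which is 0 because [T - l] is the sum of a
    bijection and of a nilpotent operator ([index_meromorphic]).

    The analysis rests on the Hahn-Banach theorem, for the projection [p] and for
    the closedness of finite dimensional extensions of closed subspaces, and on
    the open mapping theorem for a map [(x, y) |-> S x + y] between closed
    subspaces, for [closed_image] and [index_meromorphic]. *)

(** * Real-valued norms and bounded operators *)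

Section RealNorm.
Context {R : realType}.
Implicit Types V W : normedModType R[i].

(** The norm of a complex normed module has its values in [R[i]]; estimates are
    made on its real part, with values in the ordered field [R]. *)
Definition rnorm V (x : V) : R := complex.Re `|x|.

Lemma normrE V (x : V) : `|x| = (rnorm x)%:C%C.
Proof.
have: 0 <= `|x| := normr_ge0 x.
by rewrite /rnorm lecE /=; case: (`|x|) => a b /= /andP[/eqP-> _].
Qed.

Lemma rnorm_ge0 V (x : V) : 0 <= rnorm x.
Proof. by have := normr_ge0 x; rewrite normrE ler0c. Qed.

Lemma rnormD V (x y : V) : rnorm (x + y) <= rnorm x + rnorm y.
Proof. by have := ler_normD x y; rewrite !normrE -rmorphD lecR. Qed.

Lemma rnormN V (x : V) : rnorm (- x) = rnorm x.
Proof. by rewrite /rnorm normrN. Qed.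

Lemma rnormB V (x y : V) : rnorm (x - y) <= rnorm x + rnorm y.
Proof. by rewrite -(rnormN y) rnormD. Qed.

Lemma rnorm_distC V (x y : V) : rnorm (x - y) = rnorm (y - x).
Proof. by rewrite /rnorm distrC. Qed.

Lemma rnormZ V (c : R[i]) (x : V) : rnorm (c *: x) = complex.Re `|c| * rnorm x.
Proof.
rewrite /rnorm normrZ [`|x|]normrE.
have: 0 <= `|c| := normr_ge0 c.
rewrite lecE /=; case: (`|c|) => a b /= /andP[/eqP-> _].
by rewrite /= mulr0 subr0.
Qed.

Lemma rnorm0 V : rnorm (0 : V) = 0.
Proof. by rewrite /rnorm normr0. Qed.

Lemma rnorm_eq0 V (x : V) : rnorm x = 0 -> x = 0.
Proof. by move=> h; apply/eqP; rewrite -normr_eq0 normrE h. Qed.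

Lemma Re_norm_ge0 (c : R[i]) : 0 <= complex.Re `|c|.
Proof. by have := normr_ge0 c; rewrite lecE => /andP[]. Qed.

Lemma Re_norm_real (t : R) : complex.Re `|t%:C%C| = `|t|.
Proof. by rewrite normc_def /= expr0n /= addr0 sqrtr_sqr. Qed.

Lemma rnorm_small V (x : V) : (forall e, 0 < e -> rnorm x < e) -> x = 0.
Proof.
move=> h; apply: rnorm_eq0; apply/eqP; rewrite eq_le rnorm_ge0 andbT leNgt.
by apply/negP => /h; rewrite ltxx.
Qed.

Lemma ball_rnorm V (x y : V) (e : R) : ball x e%:C%C y <-> rnorm (x - y) < e.
Proof. by rewrite -ball_normE /ball_ /= normrE ltcR. Qed.

Lemma gt0_complexE (e : R[i]) : 0 < e -> e = (complex.Re e)%:C%C /\ 0 < complex.Re e.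
Proof. by rewrite ltcE; case: e => a b /= /andP[/eqP-> ->]. Qed.

Lemma closed_rnormP V (Y : set V) :
  closed Y <-> forall x, (forall e, 0 < e -> exists2 y, Y y & rnorm (x - y) < e) -> Y x.
Proof.
split=> [cY x h|h x clx].
  apply: cY => B /nbhs_ballP[e /= e0 sB].
  have [eE e0'] := gt0_complexE e0.
  have [y Yy xy] := h _ e0'.
  by exists y; split=> //; apply: sB; rewrite eE; apply/ball_rnorm.
apply: h => e e0.
have e0' : 0 < e%:C%C by rewrite ltcR.
have [y [Yy /ball_rnorm xy]] := clx _ (nbhsx_ballx x _ e0').
by exists y.
Qed.

Definition bounded_op V W (S : V -> W) :=
  exists2 C : R, 0 <= C & forall x, rnorm (S x) <= C * rnorm x.

Lemma continuous_bounded_op V W (S : {linear V -> W}) :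
  continuous S -> bounded_op S.
Proof.
move=> cS; have /linear_boundedP [M [Mr h]] := (linear_bounded_continuous S).2 cS.
pose C : R := Num.max 0 (complex.Re M) + 1.
have MC : M < C%:C%C.
  have : M = (complex.Re M)%:C%C.
    by move: Mr; case: (M) => a b; rewrite complex_real /= => /eqP->.
  by move=> ->; rewrite ltcR /C ltr_pwDr // le_max lexx orbT.
exists C; first by rewrite /C addr_ge0 // le_max lexx.
by move=> x; have := h _ MC x; rewrite !normrE -rmorphM lecR.
Qed.

Lemma bounded_opZ V W (c : R[i]) (S : V -> W) :
  bounded_op S -> bounded_op (fun x => c *: S x).
Proof.
move=> [A A0 hA]; exists (complex.Re `|c| * A).
  by rewrite mulr_ge0 // Re_norm_ge0.
by move=> x; rewrite rnormZ -mulrA ler_wpM2l // Re_norm_ge0.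
Qed.

Lemma bounded_opD V W (S S' : V -> W) :
  bounded_op S -> bounded_op S' -> bounded_op (fun x => S x + S' x).
Proof.
move=> [A A0 hA] [B B0 hB]; exists (A + B); first exact: addr_ge0.
by move=> x; rewrite mulrDl (le_trans (rnormD _ _)) // lerD.
Qed.

Lemma bounded_op0 V W : bounded_op (fun _ : V => 0 : W).
Proof. by exists 0 => // x; rewrite rnorm0 mul0r. Qed.

Lemma bounded_op_id V : bounded_op (@id V).
Proof. by exists 1 => // x; rewrite mul1r. Qed.

Lemma bounded_op_comp V1 V2 V3 (S : V2 -> V3) (S' : V1 -> V2) :
  bounded_op S -> bounded_op S' -> bounded_op (S \o S').
Proof.
move=> [A A0 hA] [B B0 hB]; exists (A * B); first exact: mulr_ge0.
by move=> x /=; rewrite (le_trans (hA _)) // -mulrA ler_wpM2l.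
Qed.

Lemma bounded_op_iter V (S : V -> V) n : bounded_op S -> bounded_op (iter n S).
Proof.
by move=> bS; elim: n => [|n IH]; [exact: bounded_op_id|exact: (bounded_op_comp bS IH)].
Qed.

Lemma bounded_op_sum V W (n : nat) (S : 'I_n -> V -> W) :
  (forall i, bounded_op (S i)) -> bounded_op (fun x => \sum_i S i x).
Proof.
elim: n S => [|n IH] S bS.
  rewrite (_ : (fun _ => _) = fun=> 0); first exact: bounded_op0.
  by apply/funext => x; rewrite big_ord0.
rewrite (_ : (fun _ => _) =
    fun x => (\sum_(i < n) S (widen_ord (leqnSn n) i) x) + S ord_max x).
  by apply: bounded_opD => //; apply: IH.
by apply/funext => x; rewrite big_ord_recr.
Qed.

Lemma halving_small (r : nat -> R) (e : R) : (forall n, r n.+1 <= r n / 2) ->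
  0 < e -> exists n, r n < e.
Proof.
move=> rr e0.
have hr n : r n * 2 ^+ n <= r 0%N.
  elim: n => [|n IH]; first by rewrite expr0 mulr1.
  rewrite exprS mulrA (le_trans _ IH) // ler_wpM2r ?exprn_ge0 //.
  by have := rr n; lra.
pose n := Num.truncn (r 0%N / e); exists n.
have h2 : r 0%N / e < 2 ^+ n.
  apply: lt_le_trans (truncnS_gt _) _.
  by rewrite -natrX ler_nat ltn_expl.
have p0 : 0 < 2 ^+ n :> R by rewrite exprn_gt0.
rewrite -(ltr_pM2r p0).
by move: h2; rewrite ltr_pdivrMr // => h2; have := hr n; lra.
Qed.

(** Geometric decay of the steps gives an explicit rate of convergence, which
    spares the constructions by successive approximation any filter. *)
Lemma halving_cvg (X : completeNormedModType R[i]) (u : nat -> X) (r : nat -> R) :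
  (forall n, rnorm (u n.+1 - u n) <= r n) -> (forall n, r n.+1 <= r n / 2) ->
  exists l, forall n, rnorm (l - u n) <= 2 * r n.
Proof.
move=> ur rr.
have r0 n : 0 <= r n by apply: le_trans (ur n); apply: rnorm_ge0.
have far n k : rnorm (u (n + k)%N - u n) <= 2 * r n - 2 * r (n + k)%N.
  elim: k => [|k IH]; first by rewrite addn0 !subrr rnorm0.
  rewrite addnS -(subrKA (u (n + k)%N)).
  have h1 := rnormD (u (n + k).+1 - u (n + k)%N) (u (n + k)%N - u n).
  have h2 := ur (n + k)%N; have h3 := rr (n + k)%N.
  lra.
have far' n m : (n <= m)%N -> rnorm (u m - u n) <= 2 * r n.
  move=> nm; have := far n (m - n)%N; rewrite subnKC // => h.
  by have := r0 m; lra.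
have: cvgn u.
  apply/cauchy_cvgP; apply/cauchy_ballP => e e0.
  have [eE e0'] := gt0_complexE e0.
  have [n hn] := halving_small rr (divr_gt0 e0' (ltr0n _ 4)).
  pose A := u @` [set m | (n <= m)%N].
  exists (A, A) => /=; first by split; exists n => // m /= nm; exists m.
  move=> [_ _] /= [[p hp <-] [q hq <-]].
  rewrite eE; apply/ball_rnorm.
  rewrite -(subrKA (u n)).
  have h1 := rnormD (u p - u n) (u n - u q).
  have h2 := far' _ _ hp; have := far' _ _ hq; rewrite rnorm_distC => h3.
  lra.
move=> cu; exists (limn u) => n.
rewrite leNgt; apply/negP => h.
pose e := rnorm (limn u - u n) - 2 * r n.
have e0 : 0 < e%:C%C by rewrite ltcR /e subr_gt0.
have /cvg_ballP /(_ _ e0) [N _ hN] := cu.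
have /= /ball_rnorm hm := hN (maxn N n) (leq_maxl _ _).
have h1 := rnormD (limn u - u (maxn N n)) (u (maxn N n) - u n).
rewrite subrKA in h1.
have := far' n (maxn N n) (leq_maxr _ _).
rewrite /e in hm; lra.
Qed.

End RealNorm.

(** * Linear combinations *)

(** Identities between linear combinations of vectors are decided by comparing,
    atom by atom, coefficients computed in the scalar ring. *)
Inductive lincomb (K : Type) :=
| LAtom of nat
| LZero
| LAdd of lincomb K & lincomb K
| LOpp of lincomb K
| LScale of K & lincomb K.
Arguments LZero {K}.

Section LinearCombinations.
Context {K : comNzRingType} {V : lmodType K}.

Fixpoint leval (s : seq V) (e : lincomb K) : V :=
  match e with
  | LAtom n => s`_n
  | LZero => 0
  | LAdd a b => leval s a + leval s b
  | LOpp a => - leval s a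
  | LScale c a => c *: leval s a
  end.

Fixpoint lcoef (e : lincomb K) (n : nat) : K :=
  match e with
  | LAtom m => if m == n then 1 else 0
  | LZero => 0
  | LAdd a b => lcoef a n + lcoef b n
  | LOpp a => - lcoef a n
  | LScale c a => c * lcoef a n
  end.

Lemma levalE s e : leval s e = \sum_(i < size s) lcoef e i *: s`_i.
Proof.
elim: e => /= [n||a -> b ->|a ->|c a ->].
- have [ns|sn] := ltnP n (size s).
    rewrite (bigD1 (Ordinal ns)) //= eqxx scale1r big1 ?addr0 // => i.
    by rewrite -val_eqE /= eq_sym => /negbTE->; rewrite scale0r.
  rewrite nth_default // big1 // => i _.
  by rewrite gtn_eqF ?scale0r // (leq_trans (ltn_ord i)).
- by rewrite big1 // => i _; rewrite scale0r.
- by rewrite -big_split; apply: eq_bigr => i _; rewrite scalerDl.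
- by rewrite -sumrN; apply: eq_bigr => i _; rewrite scaleNr.
- by rewrite scaler_sumr; apply: eq_bigr => i _; rewrite scalerA.
Qed.

Fixpoint lsame (n : nat) (a b : lincomb K) : Prop :=
  if n is n'.+1 then lcoef a n' = lcoef b n' /\ lsame n' a b else True.

Lemma leval_eq s a b : lsame (size s) a b -> leval s a = leval s b.
Proof.
move=> h; rewrite !levalE; apply: eq_bigr => i _; congr (_ *: _).
elim: (size s) h (nat_of_ord i) (ltn_ord i) => //= n IH [ab /IH h] j.
by rewrite ltnS leq_eqVlt => /orP[/eqP->|/h].
Qed.

End LinearCombinations.

Ltac lmod_mem x l :=
  lazymatch l with
  | nil => false
  | cons x _ => true
  | cons _ ?l => lmod_mem x l
  end.
Ltac lmod_atoms e l :=
  lazymatch e with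
  | @GRing.add _ ?a ?b => let l := lmod_atoms a l in lmod_atoms b l
  | @GRing.opp _ ?a => lmod_atoms a l
  | @GRing.scale _ _ _ ?a => lmod_atoms a l
  | @GRing.zero _ => l
  | _ => let b := lmod_mem e l in
         lazymatch b with true => l | false => constr:(cons e l) end
  end.
Ltac lmod_index x l :=
  lazymatch l with
  | cons x _ => constr:(0%N)
  | cons _ ?l => let n := lmod_index x l in constr:(S n)
  end.
Ltac lmod_reify K e l :=
  lazymatch e with
  | @GRing.add _ ?a ?b =>
      let a := lmod_reify K a l in let b := lmod_reify K b l in constr:(LAdd a b)
  | @GRing.opp _ ?a => let a := lmod_reify K a l in constr:(LOpp a)
  | @GRing.scale _ _ ?c ?a => let a := lmod_reify K a l in constr:(@LScale K c a)
  | @GRing.zero _ => constr:(@LZero K)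
  | _ => let n := lmod_index e l in constr:(@LAtom K n)
  end.
Ltac lmod_split :=
  rewrite -[LHS]scale1r;
  lazymatch goal with |- @eq ?V (@GRing.scale ?K ?W ?c ?a) ?b =>
  let l := lmod_atoms a (@nil V) in let l := lmod_atoms b l in
  let a := lmod_reify K (@GRing.scale K W c a) l in
  let b := lmod_reify K b l in
  apply: (@leval_eq _ _ l a b); rewrite /=; repeat (split; [|]); try exact: I end.
Ltac lmod := lmod_split; ring.
Ltac lmod_field := lmod_split; field.

(** * Subspaces and dimensions of quotients *)

Section LinearAlgebra.
Context {R : realType} {X : completeNormedModType R[i]}.
Implicit Types (S T : X -> X) (U V Y M N P Q : set X).
Local Notation C := R[i].

Lemma lin_subspaceP Y : lin_subspace Y <->
  Y 0 /\ forall a u v, Y u -> Y v -> Y (a *: u + v).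
Proof.
rewrite /lin_subspace; split=> -[Y0 YL]; split.
- exact: set_mem Y0.
- by move=> a u v Yu Yv; apply: set_mem; apply: YL; apply: mem_set.
- exact: mem_set Y0.
- by move=> a u v Yu Yv; apply: mem_set; apply: YL; apply: set_mem.
Qed.

Lemma subspace0 Y : lin_subspace Y -> Y 0.
Proof. by move=> /lin_subspaceP[]. Qed.

Lemma subspaceZ Y a x : lin_subspace Y -> Y x -> Y (a *: x).
Proof. by move=> /lin_subspaceP[Y0 YL] Yx; rewrite -[_ *: _]addr0; apply: YL. Qed.

Lemma subspaceD Y x y : lin_subspace Y -> Y x -> Y y -> Y (x + y).
Proof. by move=> /lin_subspaceP[Y0 YL] Yx Yy; rewrite -[x]scale1r; apply: YL. Qed.

Lemma subspaceN Y x : lin_subspace Y -> Y x -> Y (- x).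
Proof. by move=> sY Yx; rewrite -scaleN1r; apply: subspaceZ. Qed.

Lemma subspaceB Y x y : lin_subspace Y -> Y x -> Y y -> Y (x - y).
Proof. by move=> sY Yx Yy; apply: subspaceD => //; apply: subspaceN. Qed.

Lemma subspace_sum Y n (c : 'I_n -> C) (e : 'I_n -> X) :
  lin_subspace Y -> (forall j, Y (e j)) -> Y (\sum_j c j *: e j).
Proof.
move=> sY Ye; elim/big_ind: _ => [|x y Yx Yy|j _]; first exact: subspace0.
  exact: subspaceD.
exact: subspaceZ.
Qed.

Lemma lin_subspace0 : lin_subspace [set 0 : X].
Proof. by apply/lin_subspaceP; split=> //= a u v -> ->; rewrite scaler0 addr0. Qed.

Lemma lin_subspaceT : lin_subspace [set: X].
Proof. exact/lin_subspaceP. Qed.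

Lemma lin_subspaceI U V : lin_subspace U -> lin_subspace V -> lin_subspace (U `&` V).
Proof.
move=> sU sV; apply/lin_subspaceP; split; first by split; apply: subspace0.
by move=> a u v [? ?] [? ?]; split; apply: subspaceD => //; apply: subspaceZ.
Qed.

Definition addset U V : set X := [set x + y | x in U & y in V].

Lemma addsetP U V x : addset U V x <-> exists u v, [/\ U u, V v & x = u + v].
Proof.
split; first by case=> u Uu [v Vv <-]; exists u, v.
by move=> [u [v [Uu Vv ->]]]; exists u => //; exists v.
Qed.

Lemma addset_sub U V Y : lin_subspace Y -> U `<=` Y -> V `<=` Y -> addset U V `<=` Y.
Proof. by move=> sY UY VY _ [u /UY Yu [v /VY Yv <-]]; apply: subspaceD. Qed.

Lemma lin_subspaceD U V : lin_subspace U -> lin_subspace V -> lin_subspace (addset U V).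
Proof.
move=> sU sV; apply/lin_subspaceP; split.
  by apply/addsetP; exists 0, 0; rewrite addr0; split=> //; exact: subspace0.
move=> a _ _ /addsetP[u [v [Uu Vv ->]]] /addsetP[u' [v' [Uu' Vv' ->]]].
apply/addsetP; exists (a *: u + u'), (a *: v + v').
split; [by apply: subspaceD => //; apply: subspaceZ..|].
by rewrite scalerDr addrACA.
Qed.

Lemma addsetl U V : lin_subspace V -> U `<=` addset U V.
Proof. by move=> sV u Uu; exists u => //; exists 0; rewrite ?addr0 //; exact: subspace0. Qed.

Lemma addsetr U V : lin_subspace U -> V `<=` addset U V.
Proof. by move=> sU v Vv; exists 0; [exact: subspace0|exists v; rewrite ?add0r]. Qed.

Lemma linear_bundle S : linear S -> exists S' : {linear X -> X}, S = S'.
Proof.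
move=> lS; pose L := GRing.isLinear.Build _ _ _ _ S lS.
pose S' : {linear X -> X} := HB.pack S L.
by exists S'.
Qed.

Lemma lin0 S : linear S -> S 0 = 0.
Proof. by move=> /linear_bundle[S' ->]; rewrite linear0. Qed.

Lemma linD S x y : linear S -> S (x + y) = S x + S y.
Proof. by move=> /linear_bundle[S' ->]; rewrite linearD. Qed.

Lemma linB S x y : linear S -> S (x - y) = S x - S y.
Proof. by move=> /linear_bundle[S' ->]; rewrite linearB. Qed.

Lemma linZ S a x : linear S -> S (a *: x) = a *: S x.
Proof. by move=> /linear_bundle[S' ->]; rewrite linearZ. Qed.

Lemma lin_sum S n (c : 'I_n -> C) (e : 'I_n -> X) : linear S ->
  S (\sum_j c j *: e j) = \sum_j c j *: S (e j).
Proof.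
move=> /linear_bundle[S' ->]; rewrite linear_sum.
by apply: eq_bigr => j _; rewrite linearZ.
Qed.

Lemma linear_iter S n : linear S -> linear (iter n S).
Proof. by move=> lS; elim: n => [|n IH] a u v //=; rewrite IH lS. Qed.

Lemma linear_shift S (l : C) : linear S -> linear (fun x => S x - l *: x).
Proof.
move=> lS a u v; rewrite lS scalerDr opprD addrACA scalerBr.
by rewrite !scalerA mulrC.
Qed.

Lemma lin_subspace_image S U : linear S -> lin_subspace U -> lin_subspace (S @` U).
Proof.
move=> lS sU; apply/lin_subspaceP; split.
  by exists 0; [exact: subspace0|exact: lin0].
move=> a _ _ [u Uu <-] [v Uv <-]; exists (a *: u + v); last exact: lS.
by apply: subspaceD => //; apply: subspaceZ.
Qed.

Definition ker S : set X := S @^-1` [set 0].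

Lemma lin_subspace_ker S : linear S -> lin_subspace (ker S).
Proof.
move=> lS; apply/lin_subspaceP; split; first exact: lin0.
by move=> a u v; rewrite /ker /= lS => -> ->; rewrite scaler0 addr0.
Qed.

Definition spans U V n (e : 'I_n -> X) :=
  forall x, U x -> exists c : 'I_n -> C, V (x - \sum_j c j *: e j).

Definition free_mod V n (e : 'I_n -> X) :=
  forall c : 'I_n -> C, V (\sum_j c j *: e j) -> forall j, c j = 0.

Lemma sumZB n (c d : 'I_n -> C) (e : 'I_n -> X) :
  \sum_j (c j - d j) *: e j = \sum_j c j *: e j - \sum_j d j *: e j.
Proof. by rewrite -sumrB; apply: eq_bigr => j _; rewrite scalerBl. Qed.

(** The unique existence in [basis_mod] at the vector 0 is freeness modulo [V]. *)
Lemma basis_modP U V n (e : 'I_n -> X) : lin_subspace U -> lin_subspace V ->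
  basis_mod U V e <-> [/\ (forall j, U (e j)), spans U V e & free_mod V e].
Proof.
move=> sU sV; split=> [[Ue h]|[Ue sp fr]].
  split=> // [x /h [c [hc _]]|c Vc j]; first by exists c.
  have [d [_ hd]] := h 0 (subspace0 sU).
  have d0 : d = fun=> 0.
    apply: hd; rewrite sub0r; apply: subspaceN => //.
    by rewrite big1 => [|i _]; [exact: subspace0|rewrite scale0r].
  have dc : d = fun j => - c j.
    apply: hd; rewrite sub0r; apply: subspaceN => //.
    under eq_bigr do rewrite scaleNr.
    by rewrite sumrN; apply: subspaceN.
  apply: oppr_inj; rewrite oppr0.
  by have := congr1 (@^~ j) dc; rewrite d0.
split=> // x Ux; have [c hc] := sp x Ux; exists c; split=> // d hd.
apply/funext => j; apply/eqP; rewrite -subr_eq0; apply/eqP.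
apply: (fr (fun j => c j - d j)); rewrite sumZB.
have := subspaceB sV hd hc; rewrite opprB addrC addrA subrK.
by [].
Qed.

Definition hasdim U V n := exists e : 'I_n -> X, basis_mod U V e.
Definition fin U V := exists n, hasdim U V n.

(** A free family with more than [n] members would have a nonzero relation, given
    by a row of the kernel of its matrix of coefficients. *)
Lemma steinitz V k n (e : 'I_k -> X) (f : 'I_n -> X) : lin_subspace V ->
  free_mod V e -> (forall i, exists c : 'I_n -> C, V (e i - \sum_j c j *: f j)) ->
  (k <= n)%N.
Proof.
move=> sV fr /choice[c hc].
pose A := \matrix_(i < k, j < n) c i j.
rewrite leqNgt; apply/negP => nk.
have : kermx A != 0.
  rewrite kermx_eq0; apply/negP => /eqP h.
  by have := rank_leq_col A; rewrite h leqNgt nk.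
case/rowV0Pn => u /sub_kermxP uA; rewrite -subr_eq0 subr0 => /eqP; apply.
apply/rowP => i; rewrite mxE; apply: (fr (fun i => u ord0 i)).
suff -> : \sum_i u ord0 i *: e i
    = \sum_i u ord0 i *: (e i - \sum_j c i j *: f j) by exact: subspace_sum.
under [RHS]eq_bigr do rewrite scalerBr.
rewrite sumrB -[LHS]subr0; congr (_ - _).
under eq_bigr do rewrite scaler_sumr.
rewrite exchange_big big1 //= => j _.
under eq_bigr do rewrite scalerA.
rewrite -scaler_suml.
have := congr1 (fun B : 'rV_n => B ord0 j) uA; rewrite !mxE.
by under eq_bigr do rewrite mxE; move=> ->; rewrite scale0r.
Qed.

Definition adjoin n (e : 'I_n -> X) (x : X) (i : 'I_n.+1) : X :=
  if insub (val i) is Some j then e j else x.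

Lemma sum_adjoin n (e : 'I_n -> X) x (c : 'I_n.+1 -> C) :
  \sum_i c i *: adjoin e x i =
  \sum_(j < n) c (widen_ord (leqnSn n) j) *: e j + c ord_max *: x.
Proof.
rewrite big_ord_recr /= /adjoin /= insubF ?ltnn //; congr (_ + _).
by apply: eq_bigr => j _; rewrite /= valK.
Qed.

Lemma free_adjoin V n (e : 'I_n -> X) x : lin_subspace V -> free_mod V e ->
  ~ (exists c : 'I_n -> C, V (x - \sum_j c j *: e j)) -> free_mod V (adjoin e x).
Proof.
move=> sV fr nx c; rewrite sum_adjoin => Vc.
have c0 : c ord_max = 0.
  apply/eqP/negP => /negP c0; apply: nx.
  exists (fun j => - (c ord_max)^-1 * c (widen_ord (leqnSn n) j)).
  have := subspaceZ (c ord_max)^-1 sV Vc.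
  rewrite scalerDr scalerA mulVf // scale1r addrC scaler_sumr.
  congr V; congr (_ + _); rewrite -sumrN; apply: eq_bigr => j _.
  by rewrite mulNr scaleNr opprK scalerA.
rewrite c0 scale0r addr0 in Vc.
have h := fr _ Vc => j.
case: (unliftP ord_max j) => [i ->|->] //.
by have := h i; congr (c _ = _); apply: val_inj; rewrite /= /bump leqNgt ltn_ord.
Qed.

(** The family [f] need not lie in [U], so that finiteness passes at once to
    subspaces of [U] and to quotients.  A free family in [U] of maximal size, which
    [steinitz] bounds, is a basis. *)
Lemma fin_of_span U V n (f : 'I_n -> X) : lin_subspace U -> lin_subspace V ->
  spans U V f -> exists2 k, (k <= n)%N & hasdim U V k.
Proof.
move=> sU sV sp.
pose P k := `[< exists e : 'I_k -> X, (forall j, U (e j)) /\ free_mod V e >].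
have P0 : exists k, P k.
  exists 0%N; apply/asboolP; exists (fun=> 0); split=> [j|c _ j]; by case: j.
have Pn k : P k -> (k <= n)%N.
  by move=> /asboolP[e [Ue fr]]; apply: (steinitz sV fr) => i; apply: sp.
case: (ex_maxnP P0 Pn) => k Pk maxk; exists k; first exact: Pn.
move/asboolP: Pk => [e [Ue fr]]; exists e; apply/basis_modP => //; split=> //.
move=> x Ux; apply: contrapT => nx.
suff /maxk : P k.+1 by rewrite ltnn.
apply/asboolP; exists (adjoin e x); split; last exact: free_adjoin.
by move=> j; rewrite /adjoin; case: insub.
Qed.

Lemma hasdim_uniq U V m n : lin_subspace U -> lin_subspace V ->
  hasdim U V m -> hasdim U V n -> m = n.
Proof.
move=> sU sV [e /basis_modP[//|//|Ue spe fre]] [f /basis_modP[//|//|Uf spf frf]].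
apply/eqP; rewrite eqn_leq; apply/andP; split.
  by apply: (steinitz sV fre) => i; apply: spf.
by apply: (steinitz sV frf) => i; apply: spe.
Qed.

Lemma fin_sub U V U' V' : lin_subspace U -> lin_subspace V ->
  lin_subspace U' -> lin_subspace V' ->
  U' `<=` U -> V `<=` V' -> fin U V -> fin U' V'.
Proof.
move=> sU sV sU' sV' UU VV [n [f /basis_modP[//|//|_ sp _]]].
have [x /UU /sp[c hc]|k _ hk] := @fin_of_span U' V' n f sU' sV'.
  by exists c; apply: VV.
by exists k.
Qed.

Lemma hasdim_add U V W m n : lin_subspace U -> lin_subspace V -> lin_subspace W ->
  W `<=` V -> V `<=` U -> hasdim U V m -> hasdim V W n -> hasdim U W (m + n).
Proof.
move=> sU sV sW WV VU [e /basis_modP[//|//|Ue spe fre]] [f /basis_modP[//|//|Vf spf frf]].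
pose g (i : 'I_(m + n)) := match fintype.split i with inl j => e j | inr j => f j end.
have gl j : g (lshift n j) = e j by rewrite /g (unsplitK (inl j)).
have gr j : g (rshift m j) = f j by rewrite /g (unsplitK (inr j)).
have sumg (c : 'I_(m + n) -> C) : \sum_i c i *: g i =
    \sum_j c (lshift n j) *: e j + \sum_j c (rshift m j) *: f j.
  by rewrite big_split_ord /=; congr (_ + _); apply: eq_bigr => j _; rewrite ?gl ?gr.
exists g; apply/basis_modP => //; split.
- by move=> i; rewrite /g; case: fintype.split => j //; apply: VU.
- move=> x /spe[c /spf[d hd]].
  exists (fun i => match fintype.split i with inl j => c j | inr j => d j end).
  rewrite sumg opprD addrA.
  under eq_bigr do rewrite (unsplitK (inl _)).
  by under [X in _ - X]eq_bigr do rewrite (unsplitK (inr _)).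
- move=> c; rewrite sumg => Wc.
  have Vf' : V (\sum_j c (rshift m j) *: f j) by exact: subspace_sum.
  have c1 : forall j, c (lshift n j) = 0.
    apply: fre; have := subspaceB sV (WV _ Wc) Vf'.
    by rewrite addrK.
  rewrite big1 ?add0r in Wc; last by move=> j _; rewrite c1 scale0r.
  have c2 := frf _ Wc.
  by move=> i; rewrite -(splitK i); case: (fintype.split i) => j /=.
Qed.

Lemma fin_trans U V W : lin_subspace U -> lin_subspace V -> lin_subspace W ->
  W `<=` V -> V `<=` U -> fin U V -> fin V W -> fin U W.
Proof.
by move=> sU sV sW WV VU [m hm] [n hn]; exists (m + n)%N; apply: (hasdim_add sU sV).
Qed.

Lemma hasdim_split U V W k : lin_subspace U -> lin_subspace V -> lin_subspace W ->
  W `<=` V -> V `<=` U -> hasdim U W k ->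
  exists m n, [/\ hasdim U V m, hasdim V W n & k = (m + n)%N].
Proof.
move=> sU sV sW WV VU hk.
have fUW : fin U W by exists k.
have [m hm] : fin U V by exact: (fin_sub sU sW sU sV _ WV fUW).
have [n hn] : fin V W by exact: (fin_sub sU sW sV sW VU _ fUW).
exists m, n; split=> //; apply: (hasdim_uniq sU sW hk).
exact: (hasdim_add sU sV).
Qed.

Lemma hasdim0 U V : lin_subspace U -> lin_subspace V -> hasdim U V 0 -> U `<=` V.
Proof.
move=> sU sV [e /basis_modP[//|//|_ sp _]] x /sp[c].
by rewrite big_ord0 subr0.
Qed.

Lemma hasdim_refl U V : lin_subspace U -> lin_subspace V -> U `<=` V -> hasdim U V 0.
Proof.
move=> sU sV UV; exists (fun=> 0); apply/basis_modP => //; split=> [[]//|x /UV Vx|c _ []//].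
by exists (fun=> 0); rewrite big_ord0 subr0.
Qed.

(** A linear map inducing a bijection of [U / V] onto [U' / V'] preserves the
    dimension.  With the identity for [S] this covers the second isomorphism
    theorem and the quotients of direct sums. *)
Lemma hasdim_iso S U V U' V' n : linear S -> lin_subspace U -> lin_subspace V ->
  lin_subspace U' -> lin_subspace V' ->
  (forall x, U x -> U' (S x)) ->
  (forall y, U' y -> exists2 x, U x & V' (y - S x)) ->
  (forall x, U x -> (V x <-> V' (S x))) -> V `<=` U ->
  hasdim U V n <-> hasdim U' V' n.
Proof.
move=> lS sU sV sU' sV' SU sur ker VU; split.
  move=> [e /basis_modP[//|//|Ue sp fr]]; exists (fun j => S (e j)).
  apply/basis_modP => //; split=> [j|y /sur[x Ux xy]|c Vc]; first exact: SU.
    have [c hc] := sp _ Ux; exists c.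
    rewrite -(subrKA (S x)) -lin_sum // -linB //.
    by apply: subspaceD => //; apply/ker => //; apply: VU.
  apply: fr; apply/ker; first exact: subspace_sum.
  by rewrite lin_sum.
move=> [e /basis_modP[//|//|Ue sp fr]].
have /choice[f hf] : forall j, exists x, U x /\ V' (e j - S x).
  by move=> j; have [x ? ?] := sur _ (Ue j); exists x.
have Uf j : U (f j) := (hf j).1.
have ef c : V' (\sum_j c j *: e j - S (\sum_j c j *: f j)).
  rewrite lin_sum // -sumrB.
  under eq_bigr do rewrite -scalerBr.
  by apply: subspace_sum => // j; case: (hf j).
exists f; apply/basis_modP => //; split=> // [x Ux|c Vc].
  have [c hc] := sp _ (SU _ Ux); exists c.
  apply/ker; first by apply: subspaceB => //; apply: subspace_sum.
  by rewrite linB // -(subrKA (\sum_j c j *: e j)); apply: subspaceD.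
apply: fr; rewrite -[X in V' X](subrK (S (\sum_j c j *: f j))).
apply: subspaceD => //; apply/ker => //; exact: subspace_sum.
Qed.

Lemma hasdim_iso2 U V n : lin_subspace U -> lin_subspace V ->
  hasdim U (U `&` V) n <-> hasdim (addset U V) V n.
Proof.
move=> sU sV; apply: (@hasdim_iso id) => //.
- exact: lin_subspaceI.
- exact: lin_subspaceD.
- exact: addsetl.
- by move=> _ /addsetP[u [v [Uu Vv ->]]]; exists u => //; rewrite addrAC subrr add0r.
- by move=> x Ux; split=> [[]|].
Qed.

Lemma dim_quoE U V n : lin_subspace U -> lin_subspace V -> hasdim U V n ->
  dim_quo U V = (n%:Z)%:E.
Proof.
move=> sU sV hn; rewrite /dim_quo /inf_nat.
case: pselect => [ex|]; last by case; exists n; apply/asboolP.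
case: ex_minnP => m /asboolP hm _.
by rewrite (hasdim_uniq sU sV hm hn).
Qed.

Lemma dim_quo_fin U V : (dim_quo U V < +oo)%E <-> fin U V.
Proof.
rewrite /dim_quo /inf_nat; case: pselect => [ex|nex] /=.
  by split=> // _; case: ex => n /asboolP hn; exists n.
by split=> // -[n hn]; case: nex; exists n; apply/asboolP.
Qed.

End LinearAlgebra.

(** * The Hahn-Banach theorem *)

Section HahnBanach.
Context {R : realType} {X : completeNormedModType R[i]}.
Implicit Types (S T : X -> X) (F H U V Y M N : set X).
Local Notation C := R[i].
Local Notation "t *r x" := ((t%:C%C : R[i]) *: x) (at level 40).

Definition real_subspace H :=
  [/\ H 0, forall x y, H x -> H y -> H (x + y) & forall t x, H x -> H (t *r x)].

Lemma realB H x y : real_subspace H -> H x -> H y -> H (x - y).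
Proof.
move=> [H0 HD HZ] Hx Hy; apply: HD => //.
suff -> : - y = (-1) *r y by exact: HZ.
by lmod.
Qed.

Let rnormZr (t : R) (x : X) : rnorm (t *r x) = `|t| * rnorm x.
Proof. by rewrite rnormZ Re_norm_real. Qed.

Section Separation.
Variables (e : X) (d : R).
Hypothesis d0 : 0 < d.

Definition far_subspace H :=
  real_subspace H /\ forall h, H h -> d <= rnorm (e - h).

(** On the sum of [H] and the line of [e], the functional that vanishes on [H]
    and is 1 at [e] has norm at most [1 / d], because [H] stays at distance [d] of
    [e]. *)
Lemma far_coef H u v s t : far_subspace H -> H (u - s *r e) -> H (v - t *r e) ->
  `|s - t| * d <= rnorm (u - v).
Proof.
move=> [sH fH] Hu Hv; have [st|st] := eqVneq (s - t) 0.
  by rewrite st normr0 mul0r rnorm_ge0.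
have [_ _ HZ] := sH.
have Huv := HZ (- (s - t)^-1) _ (realB sH Hu Hv).
have -> : u - v = (s - t) *r (e - (- (s - t)^-1) *r (u - s *r e - (v - t *r e))).
  by lmod_field; rewrite -rmorphB fmorph_eq0.
by rewrite rnormZr ler_wpM2l // fH.
Qed.

(** The value [s] at [x] of an extension with the same bound has to lie between
    [t - |u - x| / d] and [t + |u - x| / d] for all [u] in [t e + H]; by [far_coef]
    the supremum of the former numbers does. *)
Lemma far_extend H x : far_subspace H ->
  exists s : R, far_subspace [set z | exists t : R, H (z - t *r (x - s *r e))].
Proof.
move=> gH; have [[H0 HD HZ] fH] := gH; have sH : real_subspace H by [].
pose A := [set r | exists t u, H (u - t *r e) /\ r = t - rnorm (u - x) / d].
have ubA t u : H (u - t *r e) -> forall r, A r -> r <= t + rnorm (u - x) / d.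
  move=> Hu _ [t' [u' [Hu' ->]]].
  have h1 := far_coef gH Hu' Hu; have h2 := ler_norm (t' - t).
  have h3 : rnorm (u' - u) <= rnorm (u' - x) + rnorm (u - x).
    by rewrite -(subrKA x) (rnorm_distC u); exact: rnormD.
  rewrite lerBlDr -addrA -mulrDl -lerBlDl ler_pdivlMr // addrC.
  have : (t' - t) * d <= `|t' - t| * d by rewrite ler_pM2r.
  lra.
have A0 : A !=set0.
  by exists (0 - rnorm (0 - x) / d), 0, 0; rewrite scale0r subr0.
have hsA : has_sup A.
  split=> //; exists (0 + rnorm (0 - x) / d) => r Ar.
  by apply: (ubA 0 0) => //; rewrite scale0r subr0.
pose s := sup A.
have hs t u : H (u - t *r e) -> `|t - s| * d <= rnorm (u - x).
  move=> Hu; rewrite -ler_pdivlMr // ler_norml; apply/andP; split.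
    suff: s <= t + rnorm (u - x) / d by lra.
    by apply: ge_sup => // r; apply: ubA.
  suff: t - rnorm (u - x) / d <= s by lra.
  by apply: sup_upper_bound => //; exists t, u.
exists s; split.
  split.
  - by exists 0; rewrite scale0r subr0.
  - move=> y z [a Hy] [b Hz]; exists (a + b).
    suff -> : y + z - (a + b) *r (x - s *r e) =
      (y - a *r (x - s *r e)) + (z - b *r (x - s *r e)) by exact: HD.
    by lmod.
  - move=> a y [b Hy]; exists (a * b).
    suff -> : a *r y - (a * b) *r (x - s *r e) = a *r (y - b *r (x - s *r e)).
      exact: HZ.
    by lmod.
move=> z [t Hz].
have [t0|t0] := eqVneq t 0.
  by move: Hz; rewrite t0 scale0r subr0 => /fH.
pose u := (s + t^-1) *r e - t^-1 *r (z - t *r (x - s *r e)).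
have -> : e - z = t *r (u - x).
  by rewrite /u; lmod_field; rewrite ?fmorph_eq0.
have Hu : H (u - (s + t^-1) *r e).
  suff -> : u - (s + t^-1) *r e = (- t^-1) *r (z - t *r (x - s *r e)) by exact: HZ.
  by rewrite /u; lmod_field; rewrite ?fmorph_eq0.
have := ler_wpM2l (normr_ge0 t) (hs _ _ Hu).
by rewrite addrC addKr mulrA -normrM divff // normr1 mul1r rnormZr.
Qed.

(** Zorn's lemma applies to the unions of [F] with a set, so that the empty
    chain causes no trouble. *)
Lemma far_hyperplane F : far_subspace F -> exists H,
  [/\ F `<=` H, far_subspace H & forall x, exists t : R, H (x - t *r e)].
Proof.
move=> gF; have [[F0 FD FZ] fF] := gF.
pose P A := far_subspace (F `|` A).
have [A [PA maxA]] : exists A, P A /\ forall B, A `<` B -> ~ P B.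
  apply: Zorn_bigcup => G GP tot.
  have pick x y : (F `|` \bigcup_(A in G) A) x -> (F `|` \bigcup_(A in G) A) y ->
      exists2 B, far_subspace B & [/\ B x, B y & B `<=` F `|` \bigcup_(A in G) A].
    have sG B : G B -> F `|` B `<=` F `|` \bigcup_(A in G) A.
      by move=> GB; apply: setUS; apply: bigcup_sup.
    case=> [Fx|[A GA Ax]]; case=> [Fy|[B GB By]].
    - by exists F => //; split=> // z; left.
    - by exists (F `|` B); [exact: GP|split; [left|right|exact: sG]].
    - by exists (F `|` A); [exact: GP|split; [right|left|exact: sG]].
    - case: (tot _ _ GA GB) => [AB|BA].
        by exists (F `|` B); [exact: GP|split; [right; exact: AB|right|exact: sG]].
      by exists (F `|` A); [exact: GP|split; [right|right; exact: BA|exact: sG]].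
  split; first split.
  - by left.
  - by move=> x y hx hy; have [B [[_ BD _] _] [Bx By]] := pick x y hx hy; apply; apply: BD.
  - by move=> t x hx; have [B [[_ _ BZ] _] [Bx _]] := pick x x hx hx; apply; apply: BZ.
  - by move=> x hx; have [B [_ fB] [Bx _ _]] := pick x x hx hx; apply: fB.
exists (F `|` A); split=> [z Fz||x] //; first by left.
have [s gB] := far_extend x PA; set B := [set z | _] in gB.
have AB : F `|` A `<=` B by move=> z Az; exists 0; rewrite scale0r subr0.
have FB : F `|` B = B by apply/setUidPr => z Fz; apply: AB; left.
exists s; apply: contrapT => nx; apply: (maxA B); last by rewrite /P FB.
split=> [z Az|BA]; first by apply: AB; right.
apply: nx; right; apply: BA; exists 1.
by have [[H0 _ _] _] := PA; rewrite scale1r subrr.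
Qed.

End Separation.

(** A real hyperplane at positive distance of [e] is the kernel of a bounded real
    functional [f]; the complex functional is [x |-> f x - i f (i x)]. *)
Lemma hahn_banach M e : lin_subspace M -> closed M -> ~ M e ->
  exists phi : X -> C, [/\ forall a u v, phi (a *: u + v) = a * phi u + phi v,
    exists2 K, 0 <= K & forall x, complex.Re `|phi x| <= K * rnorm x,
    forall x, M x -> phi x = 0 & phi e = 1].
Proof.
move=> sM cM nMe.
have [d d0 hd] : exists2 d, 0 < d & forall h, M h -> d <= rnorm (e - h).
  apply: contrapT => nd; apply: nMe; apply: (closed_rnormP M).1 => // x x0.
  apply: contrapT => nx; apply: nd; exists x => // h Mh.
  by rewrite leNgt; apply/negP => hx; apply: nx; exists h.
have gM : far_subspace e d M.
  by split=> //; split=> [|x y|t x]; [exact: subspace0|exact: subspaceD|exact: subspaceZ].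
have [H [MH gH /choice[f hf]]] := far_hyperplane d0 gM.
have [sH fH] := gH; have [H0 HD HZ] := sH.
have fU x t : H (x - t *r e) -> f x = t.
  move=> Hx; have := far_coef gH (hf x) Hx; rewrite subrr rnorm0.
  by rewrite pmulr_lle0 // normr_le0 subr_eq0 => /eqP.
have fD x y : f (x + y) = f x + f y.
  apply: fU; have := HD _ _ (hf x) (hf y).
  by congr H; lmod.
have fZ t x : f (t *r x) = t * f x.
  apply: fU; have := HZ t _ (hf x).
  by congr H; lmod.
have fM x : M x -> f x = 0 by move=> Mx; apply: fU; rewrite scale0r subr0; apply: MH.
have fe : f e = 1 by apply: fU; rewrite scale1r subrr.
have fle x : `|f x| <= d^-1 * rnorm x.
  have H0' : H (0 - 0 *r e) by rewrite scale0r subr0.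
  have := far_coef gH (hf x) H0'.
  by rewrite !subr0 ler_pdivlMl // mulrC.
pose i : C := Complex 0 1.
pose F x : C := Complex (f x) (- f (i *: x)).
have FL a u v : F (a *: u + v) = a * F u + F v.
  have aE (w : X) : a *: w = (complex.Re a) *r w + (complex.Im a) *r (i *: w).
    rewrite scalerA -scalerDl; congr (_ *: _).
    case: (a) => p q; apply/eqP.
    by rewrite eq_complex /= !(mulr0, mulr1, mul0r, addr0, subr0, add0r) !eqxx.
  have iE (w : X) : i *: (i *: w) = (-1) *r w.
    rewrite scalerA; congr (_ *: _); apply/eqP; rewrite eq_complex /=.
    by rewrite !(mulr0, mulr1, mul0r, addr0, sub0r) !eqxx.
  have iaE (w : X) : i *: (a *: w) = (complex.Re a) *r (i *: w) - (complex.Im a) *r w.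
    have -> : i *: (a *: w) = a *: (i *: w) by lmod.
    by rewrite aE iE; lmod.
  have fN (w : X) : f (- w) = - f w.
    have -> : - w = (-1) *r w by lmod.
    by rewrite fZ mulN1r.
  rewrite /F scalerDr !fD iaE aE !fD fN !fZ.
  case: (a) => p q; apply/eqP; rewrite eq_complex /=.
  by apply/andP; split; apply/eqP; ring.
have Fe : F e != 0 by rewrite eq_complex /= fe oner_eq0.
exists (fun x => (F e)^-1 * F x); split.
- by move=> a u v; rewrite FL mulrDr mulrCA.
- exists (complex.Re `|(F e)^-1| * (2 * d^-1)).
    by rewrite mulr_ge0 ?Re_norm_ge0 // mulr_ge0 // invr_ge0 ltW.
  move=> x.
  have -> : complex.Re `|(F e)^-1 * F x| = complex.Re `|(F e)^-1| * complex.Re `|F x|.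
    rewrite normrM; have := normr_ge0 (F e)^-1; have := normr_ge0 (F x).
    rewrite !lecE; case: (`|_|) => p q; case: (`|_|) => p' q' /=.
    by move=> /andP[/eqP-> _] /andP[/eqP-> _]; rewrite mulr0 subr0.
  rewrite -!mulrA ler_wpM2l ?Re_norm_ge0 //.
  have -> : F x = (f x)%:C%C + i * (- f (i *: x))%:C%C.
    apply/eqP; rewrite eq_complex /=.
    by rewrite !(mulr0, mulr1, mul0r, mul1r, addr0, subr0, add0r) !eqxx.
  have i1 : `|i| = 1 by rewrite normc_def /= expr0n expr1n add0r sqrtr1.
  have ni : complex.Re `|i * (- f (i *: x))%:C%C| = `|f (i *: x)|.
    by rewrite normrM i1 mul1r Re_norm_real normrN.
  have nx : rnorm (i *: x) = rnorm x by rewrite rnormZ i1 mul1r.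
  have h := ler_normD (f x)%:C%C (i * (- f (i *: x))%:C%C).
  move: h; rewrite lecE => /andP[_ h]; apply: le_trans h _.
  have ReD (p q : C) : complex.Re (p + q) = complex.Re p + complex.Re q.
    by case: p; case: q.
  rewrite ReD ni Re_norm_real.
  have := fle x; have := fle (i *: x); rewrite nx.
  lra.
- move=> x Mx; rewrite (_ : F x = 0) ?mulr0 // /F !fM ?oppr0 //.
  exact: subspaceZ.
- by rewrite mulVf.
Qed.

End HahnBanach.

(** * Finite dimensional extensions and projections *)

Section FiniteDimension.
Context {R : realType} {X : completeNormedModType R[i]}.
Implicit Types (S T : X -> X) (F U V W Y M N : set X).
Local Notation C := R[i].

Lemma closed_set0 : closed [set 0 : X].
Proof.
apply/closed_rnormP => x hx /=; apply: rnorm_small => e e0.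
by have [_ ->] := hx e e0; rewrite subr0.
Qed.

Definition addline V (v : X) : set X := [set x | exists c : C, V (x - c *: v)].

Lemma lin_subspace_addline V v : lin_subspace V -> lin_subspace (addline V v).
Proof.
move=> sV; apply/lin_subspaceP; split; first by exists 0; rewrite scale0r subr0; apply: subspace0.
move=> a x y [c Vx] [d Vy]; exists (a * c + d).
suff -> : a *: x + y - (a * c + d) *: v = a *: (x - c *: v) + (y - d *: v).
  by apply: subspaceD => //; apply: subspaceZ.
by lmod.
Qed.

(** If [v] is not in [V], a continuous functional that vanishes on [V] and is 1
    at [v] computes the coefficient of [v] in a limit. *)
Lemma closed_addline V v : lin_subspace V -> closed V -> closed (addline V v).
Proof.
move=> sV cV; have [Vv|nVv] := pselect (V v).
  rewrite (_ : addline V v = V) //; apply/seteqP; split=> [x [c Vx]|x Vx].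
    by rewrite -(subrK (c *: v) x); apply: subspaceD => //; apply: subspaceZ.
  by exists 0; rewrite scale0r subr0.
have [phi [phiL [K K0 phiK] phiV phiv]] := hahn_banach sV cV nVv.
have phi0 : phi 0 = 0 by apply: phiV; apply: subspace0.
have phiZ a x : phi (a *: x) = a * phi x by rewrite -[_ *: _]addr0 phiL phi0 addr0.
have phiB x y : phi (x - y) = phi x - phi y.
  by rewrite addrC -scaleN1r phiL mulN1r addrC.
apply/closed_rnormP => x hx; exists (phi x).
apply: (closed_rnormP V).1 => // e e0.
pose L := 1 + K * rnorm v.
have L0 : 0 < L by rewrite ltr_pwDl // mulr_ge0 // rnorm_ge0.
have [y [c Vy] xy] := hx (e / L) (divr_gt0 e0 L0).
have yc : phi y = c.
  by apply/eqP; rewrite -subr_eq0 -[c]mulr1 -phiv -phiZ -phiB phiV.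
exists (y - c *: v) => //; rewrite -yc.
have -> : x - phi x *: v - (y - phi y *: v) = (x - y) - phi (x - y) *: v.
  by rewrite phiB; lmod.
apply: le_lt_trans (rnormB _ _) _; rewrite rnormZ.
move: xy; rewrite ltr_pdivlMr //; apply: le_lt_trans.
rewrite /L mulrDr mulr1 lerD2l mulrA ler_wpM2r ?rnorm_ge0 //.
by rewrite mulrC phiK.
Qed.

(** Lines are added to [V] one at a time until [U] is reached. *)
Lemma closed_fin U V : lin_subspace U -> lin_subspace V -> closed V -> V `<=` U ->
  fin U V -> closed U.
Proof.
move=> sU + + + [n]; elim/ltn_ind: n V => n IH V sV cV VU hn.
have [UV|/existsNP[x /not_implyP[Ux nVx]]] := pselect (forall x, U x -> V x).
  by rewrite (_ : U = V) //; apply/seteqP.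
have sW := lin_subspace_addline x sV.
have VW : V `<=` addline V x by move=> y Vy; exists 0; rewrite scale0r subr0.
have WU : addline V x `<=` U.
  move=> y [c Vy]; rewrite -(subrK (c *: x) y).
  by apply: subspaceD => //; [apply: VU|apply: subspaceZ].
have [m [k [hm hk nmk]]] := hasdim_split sU sW sV VW WU hn.
have k0 : (0 < k)%N.
  rewrite lt0n; apply/negP => /eqP k0; rewrite k0 in hk; apply: nVx.
  by apply: (hasdim0 sW sV hk); exists 1; rewrite scale1r subrr; apply: subspace0.
have mn : (m < n)%N by rewrite nmk -addn1 leq_add2l.
exact: (IH m mn _ sW (closed_addline sV cV) WU hm).
Qed.

Lemma closed_fin0 F : lin_subspace F -> fin F [set 0] -> closed F.
Proof.
move=> sF; apply: closed_fin => //; [exact: lin_subspace0|exact: closed_set0|].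
by move=> _ ->; apply: subspace0.
Qed.

(** The span of representatives of a basis of [U / V]. *)
Lemma fin_complement U V n : lin_subspace U -> lin_subspace V -> V `<=` U ->
  hasdim U V n -> exists F, [/\ lin_subspace F, F `<=` U, hasdim F [set 0] n,
    (forall x, F x -> V x -> x = 0) & forall x, U x -> exists2 f, F f & V (x - f)].
Proof.
move=> sU sV VU [e /basis_modP[//|//|Ue sp fr]].
pose F : set X := [set x | exists c : 'I_n -> C, x = \sum_j c j *: e j].
have sF : lin_subspace F.
  apply/lin_subspaceP; split.
    by exists (fun=> 0); rewrite big1 // => j _; rewrite scale0r.
  move=> a _ _ [c ->] [d ->]; exists (fun j => a * c j + d j).
  rewrite scaler_sumr -big_split; apply: eq_bigr => j _ /=.
  by rewrite scalerDl scalerA.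
exists F; split=> //.
- by move=> _ [c ->]; apply: subspace_sum.
- exists e; apply/basis_modP => //; first exact: lin_subspace0; split.
  + move=> j; exists (fun i => if i == j then 1 else 0).
    rewrite (bigD1 j) //= eqxx scale1r big1 ?addr0 // => i /negbTE->.
    by rewrite scale0r.
  + by move=> _ [c ->]; exists c; rewrite subrr.
  + by move=> c h; apply: fr; rewrite h; apply: subspace0.
- by move=> _ [c ->] /fr c0; rewrite big1 // => j _; rewrite c0 scale0r.
- by move=> x /sp[c hc]; exists (\sum_j c j *: e j) => //; exists c.
Qed.

(** The coordinates on a finite dimensional subspace extend to continuous
    functionals, since each basis vector is off the closed span of the others. *)
Lemma bounded_projection F : lin_subspace F -> fin F [set 0] ->
  exists p : X -> X, [/\ linear p, bounded_op p, forall x, F (p x) &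
                         forall x, F x -> p x = x].
Proof.
move=> sF [n [e /basis_modP[//||Fe sp fr]]]; first exact: lin_subspace0.
have sp' x : F x -> exists c : 'I_n -> C, x = \sum_j c j *: e j.
  by move=> /sp[c /= /eqP]; rewrite subr_eq0 => /eqP; exists c.
have dual (i : 'I_n) : exists phi : X -> C,
  [/\ forall a u v, phi (a *: u + v) = a * phi u + phi v,
    exists2 K, 0 <= K & forall x, complex.Re `|phi x| <= K * rnorm x &
    forall j, phi (e j) = (i == j)%:R].
  pose G : set X := [set x | exists2 c : 'I_n -> C, c i = 0 & x = \sum_j c j *: e j].
  have sG : lin_subspace G.
    apply/lin_subspaceP; split.
      by exists (fun=> 0); rewrite // big1 // => j _; rewrite scale0r.
    move=> a _ _ [c ci ->] [d di ->]; exists (fun j => a * c j + d j).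
      by rewrite ci di mulr0 addr0.
    rewrite scaler_sumr -big_split; apply: eq_bigr => j _ /=.
    by rewrite scalerDl scalerA.
  have GF : G `<=` F by move=> _ [c _ ->]; apply: subspace_sum.
  have cG : closed G.
    apply: closed_fin0 => //; apply: (fin_sub sF lin_subspace0 sG lin_subspace0 GF) => //.
    by exists n, e; apply/basis_modP => //; exact: lin_subspace0.
  have ek j : e j = \sum_k (j == k)%:R *: e k.
    rewrite (bigD1 j) //= eqxx scale1r big1 ?addr0 // => k /negbTE.
    by rewrite eq_sym => ->; rewrite scale0r.
  have nG : ~ G (e i).
    move=> [c ci h];
    have h0 : [set 0 : X] (\sum_j (c j - (i == j)%:R) *: e j).
      by rewrite sumZB -h -ek subrr.
    have := fr _ h0 i.
    by rewrite ci eqxx sub0r => /eqP; rewrite oppr_eq0 oner_eq0.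
  have [phi [phiL phiK phiG phie]] := hahn_banach sG cG nG.
  exists phi; split=> // j; have [<-|ij] := eqVneq i j; first exact: phie.
  rewrite phiG //; exists (fun k => (j == k)%:R); last exact: ek.
  by rewrite eq_sym (negbTE ij).
have /choice[phi hphi] := dual.
pose p x := \sum_i phi i x *: e i.
have lp : linear p.
  move=> a u v; rewrite /p scaler_sumr -big_split; apply: eq_bigr => i _ /=.
  by have [-> _ _] := hphi i; rewrite scalerDl scalerA.
have pe j : p (e j) = e j.
  rewrite /p (bigD1 j) //=; have [_ _ ->] := hphi j; rewrite eqxx scale1r.
  rewrite big1 ?addr0 // => i /negbTE ij; have [_ _ ->] := hphi i.
  by rewrite ij scale0r.
exists p; split=> //.
- apply: bounded_op_sum => i; have [_ [K K0 hK] _] := hphi i.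
  exists (K * rnorm (e i)); first by rewrite mulr_ge0 // rnorm_ge0.
  by move=> x; rewrite rnormZ mulrAC ler_wpM2r ?rnorm_ge0.
- by move=> x; apply: subspace_sum.
- move=> x /sp'[c ->]; rewrite lin_sum //.
  by apply: eq_bigr => j _; rewrite pe.
Qed.

End FiniteDimension.

(** * The open mapping theorem *)

Section OpenMapping.
Context {R : realType} {X : completeNormedModType R[i]}.
Implicit Types (S T : X -> X) (A B F U V W Y M N : set X).
Local Notation C := R[i].

(** Otherwise one chooses in turn points of [Y] and balls around them, the [n]-th
    one away from [A_ n], with radii decreasing so fast that the limit of the points
    lies in all the balls: it is in no [A_ n]. *)
Lemma baire_closed Y (A_ : nat -> set X) : closed Y -> Y 0 ->
  (forall y, Y y -> exists n, A_ n y) ->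
  exists n y r, [/\ 0 < r, Y y & forall y', Y y' -> rnorm (y' - y) < r ->
    forall s, 0 < s -> exists2 x, A_ n x & rnorm (y' - x) < s].
Proof.
move=> cY Y0 cover; apply: contrapT => nA.
have /choice[g hg] : forall nyr : nat * (X * R), exists ys : X * R,
    Y nyr.2.1 -> 0 < nyr.2.2 ->
    [/\ Y ys.1, rnorm (ys.1 - nyr.2.1) < nyr.2.2, 0 < ys.2 &
        forall x, A_ nyr.1 x -> ys.2 <= rnorm (ys.1 - x)].
  move=> [n [y r]] /=; apply: contrapT => nys; apply: nA; exists n, y, r.
  have [Yy r0] : Y y /\ 0 < r.
    by apply: contrapT => h; apply: nys; exists (0, 0) => Yy r0; case: h.
  split=> // y' Yy' yy' s s0; apply: contrapT => nx; apply: nys.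
  exists (y', s) => _ _; split=> //= x Ax; rewrite leNgt; apply/negP => h.
  by apply: nx; exists x.
pose fix st n : X * R := if n is m.+1 then
    let ys := g (m, st m) in (ys.1, Num.min (ys.2 / 4) ((st m).2 / 2))
  else (0, 1).
have hst n : Y (st n).1 /\ 0 < (st n).2.
  elim: n => [|n [IH1 IH2]] //=; have [? _ s0 _] := hg (n, st n) IH1 IH2.
  by split=> //; rewrite lt_min !divr_gt0.
have [n|n|l hl] := @halving_cvg _ _ (fun n => (st n).1) (fun n => (st n).2).
- have [? ?] := hst n; have [_ h _ _] := hg (n, st n) (hst n).1 (hst n).2.
  exact: ltW h.
- by rewrite /= ge_min lexx orbT.
have Yl : Y l.
  apply: (closed_rnormP Y).1 => // e e0.
  have rr n : 2 * (st n.+1).2 <= 2 * (st n).2 / 2.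
    by rewrite /= -mulrA ler_pM2l // ge_min lexx orbT.
  have [n hn] := halving_small rr e0.
  by exists (st n).1; [case: (hst n)|apply: le_lt_trans (hl n) _].
have [n An] := cover _ Yl.
have [_ _ s0 hs] := hg (n, st n) (hst n).1 (hst n).2.
have h1 := hs _ An; have := hl n.+1; rewrite rnorm_distC /= => h2.
have h3 : Num.min ((g (n, st n)).2 / 4) ((st n).2 / 2) <= (g (n, st n)).2 / 4.
  by rewrite ge_min lexx.
rewrite /= in h1 s0; lra.
Qed.

(** Solving [z = S a + b] up to half of [z], with control of the solution, and
    correcting the error repeatedly gives an exact solution. *)
Lemma approx_solve S A B Y c : linear S -> bounded_op S ->
  lin_subspace A -> closed A -> lin_subspace B -> closed B -> 0 <= c ->
  (forall z, Y z -> exists a b, [/\ A a, B b, Y (z - (S a + b)) &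
    [/\ rnorm a <= c * rnorm z, rnorm b <= c * rnorm z &
        rnorm (z - (S a + b)) <= rnorm z / 2]]) ->
  forall z, Y z -> exists a b, [/\ A a, B b, z = S a + b,
    rnorm a <= 2 * c * rnorm z & rnorm b <= 2 * c * rnorm z].
Proof.
move=> lS [L L0 hL] sA cA sB cB c0 h z Yz.
have /choice[f hf] : forall z : X, exists ab : X * X, Y z -> [/\ A ab.1, B ab.2,
    Y (z - (S ab.1 + ab.2)) & [/\ rnorm ab.1 <= c * rnorm z,
      rnorm ab.2 <= c * rnorm z & rnorm (z - (S ab.1 + ab.2)) <= rnorm z / 2]].
  move=> w; have [Yw|nYw] := pselect (Y w); last by exists (0, 0).
  by have [a [b hab]] := h w Yw; exists (a, b).
pose fix u n : X * X := if n is m.+1 then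
    let ab := f (z - (S (u m).1 + (u m).2)) in ((u m).1 + ab.1, (u m).2 + ab.2)
  else (0, 0).
pose w n := z - (S (u n).1 + (u n).2).
have w0 : w 0%N = z by rewrite /w /= (lin0 lS) addr0 subr0.
have wS n : w n.+1 = w n - (S (f (w n)).1 + (f (w n)).2).
  by rewrite /w /=; set ab := f _; rewrite (linD _ _ lS); lmod.
have Yw n : Y (w n).
  by elim: n => [|n IH]; [rewrite w0|rewrite wS; have [] := hf _ IH].
pose r n := c * rnorm (w n).
have rr n : r n.+1 <= r n / 2.
  have [_ _ _ [_ _ hw]] := hf _ (Yw n).
  by rewrite /r -mulrA ler_wpM2l // wS.
have [n||a ha] := @halving_cvg _ _ (fun n => (u n).1) r.
- have [_ _ _ [hw _ _]] := hf _ (Yw n).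
  by rewrite /= -/(w n) addrC addKr.
- exact: rr.
have [n||b hb] := @halving_cvg _ _ (fun n => (u n).2) r.
- have [_ _ _ [_ hw _]] := hf _ (Yw n).
  by rewrite /= -/(w n) addrC addKr.
- exact: rr.
have Au n : A (u n).1 /\ B (u n).2.
  elim: n => [|n [IH1 IH2]] /=; first by split; apply: subspace0.
  by have [? ? _ _] := hf _ (Yw n); split; apply: subspaceD.
have rr2 n : 2 * r n.+1 <= 2 * r n / 2 by have := rr n; lra.
exists a, b; split.
- apply: (closed_rnormP A).1 => // e e0.
  have [n hn] := halving_small rr2 e0; exists (u n).1; first by case: (Au n).
  exact: le_lt_trans (ha n) hn.
- apply: (closed_rnormP B).1 => // e e0.
  have [n hn] := halving_small rr2 e0; exists (u n).2; first by case: (Au n).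
  exact: le_lt_trans (hb n) hn.
- apply/eqP; rewrite -subr_eq0; apply/eqP; apply: rnorm_small => e e0.
  pose q n := rnorm (w n) + (L + 1) * (2 * r n).
  have qq n : q n.+1 <= q n / 2.
    have [_ _ _ [_ _ hw]] := hf _ (Yw n).
    rewrite /q [leRHS]mulrDl lerD //; first by rewrite wS.
    by rewrite -mulrA ler_wpM2l ?addr_ge0 // rr2.
  have [n hn] := halving_small qq e0; apply: le_lt_trans hn.
  have -> : z - (S a + b) = w n - (S (a - (u n).1) + (b - (u n).2)).
    by rewrite /w (linB _ _ lS); lmod.
  apply: le_trans (rnormB _ _) _; rewrite /q lerD2l mulrDl mul1r.
  apply: le_trans (rnormD _ _) _; apply: lerD; last exact: hb.
  by apply: le_trans (hL _) _; rewrite ler_wpM2l.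
- by have := ha 0%N; rewrite /r w0 /= subr0 mulrA.
- by have := hb 0%N; rewrite /r w0 /= subr0 mulrA.
Qed.

(** By Baire's theorem the sums [S a + b] with [a] and [b] of norm at most some [n]
    are dense in a ball of [Y]; by differences and scaling, every equation is solved
    up to half of its right-hand side, and [approx_solve] applies. *)
Lemma open_mapping S A B Y : linear S -> bounded_op S ->
  lin_subspace A -> closed A -> lin_subspace B -> closed B ->
  lin_subspace Y -> closed Y ->
  (forall a b, A a -> B b -> Y (S a + b)) ->
  (forall y, Y y -> exists a b, [/\ A a, B b & y = S a + b]) ->
  exists2 c : R, 0 <= c & forall y, Y y -> exists a b, [/\ A a, B b, y = S a + b,
    rnorm a <= c * rnorm y & rnorm b <= c * rnorm y].
Proof.
move=> lS bS sA cA sB cB sY cY SAB sur.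
pose A_ (n : nat) : set X := [set y | exists a b, [/\ A a, B b, y = S a + b,
  rnorm a <= n%:R & rnorm b <= n%:R]].
have cover y : Y y -> exists n, A_ n y.
  move=> /sur[a [b [Aa Bb ->]]].
  exists (Num.truncn (rnorm a + rnorm b)).+1, a, b; split=> //.
    apply: ltW (le_lt_trans _ (truncnS_gt _)).
    by rewrite lerDl rnorm_ge0.
  apply: ltW (le_lt_trans _ (truncnS_gt _)).
  by rewrite lerDr rnorm_ge0.
have [n [y [r [r0 Yy hA]]]] := baire_closed cY (subspace0 sY) cover.
pose c : R := 4 * n%:R / r.
have c0 : 0 <= c by rewrite divr_ge0 ?mulr_ge0 // ltW.
exists (2 * c); first by rewrite mulr_ge0.
apply: (approx_solve lS bS sA cA sB cB c0) => z Yz.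
have [z0|z0] := eqVneq (rnorm z) 0.
  exists 0, 0; rewrite (rnorm_eq0 z0) (lin0 lS) addr0 subr0 rnorm0 mulr0 mul0r.
  by split=> //; exact: subspace0.
have zp : 0 < rnorm z by rewrite lt_def z0 rnorm_ge0.
pose t := r / (2 * rnorm z).
have t0 : 0 < t by rewrite divr_gt0 // mulr_gt0.
have tz : t * rnorm z = r / 2 by rewrite /t; field.
have tz' : rnorm (t%:C%C *: z) = r / 2.
  by rewrite rnormZ Re_norm_real gtr0_norm.
have r8 : 0 < r / 8 by rewrite divr_gt0.
have Yz' : Y (t%:C%C *: z) by apply: subspaceZ.
have [||_ [a1 [b1 [Aa1 Bb1 -> na1 nb1]]] h1] := hA (t%:C%C *: z + y) _ _ _ r8.
- exact: subspaceD.
- by rewrite addrK tz'; lra.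
have [||_ [a2 [b2 [Aa2 Bb2 -> na2 nb2]]] h2] := hA y _ _ _ r8.
- by [].
- by rewrite subrr rnorm0.
have t0' : t%:C%C != 0 :> C by rewrite fmorph_eq0 gt_eqF.
have nt x : rnorm (t^-1%:C%C *: x) = t^-1 * rnorm x.
  by rewrite rnormZ Re_norm_real gtr0_norm // invr_gt0.
have bnd x1 x2 : rnorm x1 <= n%:R -> rnorm x2 <= n%:R ->
    rnorm (t^-1%:C%C *: (x1 - x2)) <= c * rnorm z.
  move=> hx1 hx2; rewrite nt.
  have -> : c * rnorm z = t^-1 * (2 * n%:R).
    by rewrite /c /t; field; rewrite z0 gt_eqF.
  rewrite ler_wpM2l ?invr_ge0 ?(ltW t0) //.
  by apply: le_trans (rnormB _ _) _; lra.
pose a := t^-1%:C%C *: (a1 - a2); pose b := t^-1%:C%C *: (b1 - b2).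
have Aa : A a by apply: subspaceZ => //; apply: subspaceB.
have Bb : B b by apply: subspaceZ => //; apply: subspaceB.
exists a, b; split=> //; first by apply: subspaceB => //; apply: SAB.
split; [exact: bnd|exact: bnd|].
have -> : z - (S a + b) =
    t^-1%:C%C *: ((t%:C%C *: z + y - (S a1 + b1)) - (y - (S a2 + b2))).
  by rewrite /a /b (linZ _ _ lS) (linB _ _ lS); lmod_field.
rewrite nt -(ler_pM2l t0) mulrA divff ?gt_eqF // mul1r mulrA tz.
by apply: le_trans (rnormB _ _) _; lra.
Qed.

(** The complement [F] of the range is finite dimensional, hence closed, and the
    open mapping theorem for [(x, f) |-> S x + f] bounds the component in [F]. *)
Lemma closed_image S Y : linear S -> bounded_op S -> lin_subspace Y -> closed Y ->
  S @` Y `<=` Y -> fin Y (S @` Y) -> closed (S @` Y).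
Proof.
move=> lS bS sY cY SY [n hn].
have sSY := lin_subspace_image lS sY.
have [F [sF FY hF F0 dec]] := fin_complement sY sSY SY hn.
have cF : closed F by apply: closed_fin0 => //; exists n.
have [||c c0 hc] := @open_mapping S Y F Y lS bS sY cY sF cF sY cY.
- by move=> a b Ya Fb; apply: subspaceD => //; [apply: SY; exists a|apply: FY].
- by move=> y /dec[f Ff [x Yx xy]]; exists x, f; split=> //; rewrite xy subrK.
apply/closed_rnormP => x hx.
have Yx : Y x.
  apply: (closed_rnormP Y).1 => // e /hx[y /SY Yy xy]; by exists y.
have [a [f [Ya Ff xE _ _]]] := hc x Yx.
suff f0 : f = 0 by exists a; rewrite // xE f0 addr0.
apply: rnorm_small => e e0.
have c1 : 0 < c + 1 by rewrite ltr_wpDl.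
have [_ [y Yy <-] xy] := hx (e / (c + 1)) (divr_gt0 e0 c1).
have [a' [f' [Ya' Ff' E _ nf']]] := hc (x - S y) (subspaceB sY Yx (SY _ (imageP S Yy))).
have ff : f = f'.
  apply/eqP; rewrite -subr_eq0; apply/eqP; apply: F0; first exact: subspaceB.
  exists (a' + y - a); first by apply: subspaceB => //; apply: subspaceD.
  rewrite (linB _ _ lS) (linD _ _ lS).
  have -> : S a' = x - S y - f' by rewrite E addrK.
  by rewrite xE; lmod.
rewrite ff; apply: le_lt_trans nf' _.
apply: le_lt_trans (_ : _ <= (c + 1) * rnorm (x - S y)) _.
  by rewrite ler_wpM2r ?rnorm_ge0 // lerDl.
by move: xy; rewrite ltr_pdivlMr // mulrC.
Qed.

End OpenMapping.

(** * Kernels, cokernels and index, algebraically *)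

Section AlgebraicIndex.
Context {R : realType} {X : completeNormedModType R[i]}.
Implicit Types (S T A : X -> X) (U V W Y M N P Q : set X).
Local Notation C := R[i].

Definition fin_ker T Y := fin (Y `&` ker T) [set 0].
Definition fin_coker T Y := fin Y (T @` Y).
Definition has_index T Y a b :=
  hasdim (Y `&` ker T) [set 0] a /\ hasdim Y (T @` Y) b.

Lemma has_indexP T Y : fin_ker T Y -> fin_coker T Y -> exists a b, has_index T Y a b.
Proof. by move=> [a ?] [b ?]; exists a, b. Qed.

Lemma has_index_uniq T Y a b a' b' : linear T -> lin_subspace Y ->
  has_index T Y a b -> has_index T Y a' b' -> a = a' /\ b = b'.
Proof.
move=> lT sY [ha hb] [ha' hb']; split.
  apply: (hasdim_uniq _ lin_subspace0 ha ha').
  exact: lin_subspaceI sY (lin_subspace_ker lT).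
exact: (hasdim_uniq sY (lin_subspace_image lT sY) hb hb').
Qed.

Lemma indE T Y a b : linear T -> lin_subspace Y -> has_index T Y a b ->
  ind T Y = (a%:Z - b%:Z)%:E.
Proof.
move=> lT sY [ha hb]; rewrite /ind /alpha /beta.
rewrite (dim_quoE _ lin_subspace0 ha) ?(dim_quoE sY _ hb) //.
  exact: lin_subspace_image.
exact: lin_subspaceI sY (lin_subspace_ker lT).
Qed.

Lemma invariant_image T Y : invariant T Y -> T @` Y `<=` Y.
Proof. by move=> iY _ [y Yy <-]; apply: iY. Qed.

Section Step.
Variables (T : X -> X) (M : set X).
Hypotheses (lT : linear T) (sM : lin_subspace M) (iM : invariant T M).
Let TM := T @` M.
Let K := ker T.
Let sTM : lin_subspace TM. Proof. exact: lin_subspace_image. Qed.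
Let sTTM : lin_subspace (T @` TM). Proof. exact: lin_subspace_image. Qed.
Let sK : lin_subspace K. Proof. exact: lin_subspace_ker. Qed.
Let sMK : lin_subspace (M `&` K). Proof. exact: lin_subspaceI. Qed.
Let sTMK : lin_subspace (TM `&` K). Proof. exact: lin_subspaceI. Qed.
Let L := addset (M `&` K) TM.
Let sL : lin_subspace L. Proof. exact: lin_subspaceD. Qed.
Let TM_M : TM `<=` M. Proof. exact: invariant_image. Qed.
Let L_M : L `<=` M. Proof. by apply: addset_sub => // x []. Qed.
Let TM_L : TM `<=` L. Proof. exact: addsetr. Qed.
Let K_K : TM `&` K `<=` M `&` K. Proof. by move=> x [/TM_M]. Qed.
Let set0_K : [set 0] `<=` TM `&` K. Proof. by move=> _ ->; apply: subspace0. Qed.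

Let dim_ker d : hasdim (M `&` K) (TM `&` K) d <-> hasdim L TM d.
Proof.
rewrite /L -hasdim_iso2 // (_ : M `&` K `&` TM = TM `&` K) //.
by apply/seteqP; split=> [x [[Mx Kx] Tx]|x [Tx Kx]]; split=> //; split=> //; apply: TM_M.
Qed.

Let dim_coker n : hasdim M L n <-> hasdim TM (T @` TM) n.
Proof.
apply: (@hasdim_iso _ _ T) => //.
- by move=> x Mx; exists x.
- by move=> _ [x Mx <-]; exists x => //; rewrite subrr; apply: subspace0.
- move=> x Mx; split.
    move=> /addsetP[k [y [[_ Kk] TMy ->]]]; exists y => //.
    by rewrite (linD _ _ lT) (Kk : T k = 0) add0r.
  move=> [y TMy Tyx]; apply/addsetP; exists (x - y), y; split=> //; last by rewrite subrK.
  split; first by apply: subspaceB => //; apply: TM_M.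
  by rewrite /K /ker /= (linB _ _ lT) Tyx subrr.
Qed.

(** Passing from [M] to [T M] removes the same finite dimension from the kernel
    and from the cokernel: that of [(M `&` K) / (T M `&` K)]. *)
Lemma has_index_image a b : has_index T M a b ->
  exists a' b', has_index T TM a' b' /\ (a + b' = a' + b)%N.
Proof.
move=> [ha hb].
have [d [a' [hd ha' ->]]] := hasdim_split sMK sTMK lin_subspace0 set0_K K_K ha.
have [b' [d' [hb' hd' ->]]] := hasdim_split sM sL sTM TM_L L_M hb.
have dd : d = d' by apply: (hasdim_uniq sL sTM _ hd'); apply/dim_ker.
exists a', b'; split; last by rewrite dd; lia.
by split=> //; apply/dim_coker.
Qed.

Lemma fin_ker_image : fin_ker T M -> fin_ker T TM.
Proof. exact: (fin_sub sMK lin_subspace0 sTMK lin_subspace0 K_K). Qed.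

Lemma fin_coker_image : fin_coker T M -> fin_coker T TM.
Proof.
move=> h; have [n /dim_coker hn] : fin M L by apply: (fin_sub sM sTM).
by exists n.
Qed.

(** [M / T M] is made of [L / T M], isomorphic to [(M `&` K) / (T M `&` K)], and of
    [M / L], isomorphic to [T M / T (T M)]. *)
Lemma fin_coker_preimage : fin_ker T M -> fin_coker T TM -> fin_coker T M.
Proof.
move=> fa [n /dim_coker hn].
apply: (fin_trans sM sL sTM) => //; first by exists n.
have [d /dim_ker hd] : fin (M `&` K) (TM `&` K).
  by apply: (fin_sub sMK lin_subspace0).
by exists d.
Qed.

Lemma fin_ker_preimage : fin_coker T M -> fin_ker T TM -> fin_ker T M.
Proof.
move=> fb fa; apply: (fin_trans sMK sTMK lin_subspace0) => //.
have [d /dim_ker hd] : fin L TM by apply: (fin_sub sM sTM).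
by exists d.
Qed.

End Step.

Definition power_image T n M := iter n T @` M.

Lemma power_image0 T M : power_image T 0 M = M.
Proof. exact: image_id. Qed.

Lemma power_imageS T n M : power_image T n.+1 M = T @` power_image T n M.
Proof. by rewrite /power_image -image_comp. Qed.

Lemma lin_subspace_power T n M : linear T -> lin_subspace M ->
  lin_subspace (power_image T n M).
Proof. by move=> lT sM; apply: lin_subspace_image => //; apply: linear_iter. Qed.

Lemma invariant_power T n M : invariant T M -> invariant T (power_image T n M).
Proof.
move=> iM _ [x Mx <-]; exists (T x); first exact: iM.
by rewrite -iterSr.
Qed.

Lemma invariant_iter T n M x : invariant T M -> M x -> M (iter n T x).
Proof. by move=> iM Mx; elim: n => //= n; apply: iM. Qed.

Lemma power_image_le T m n M : invariant T M -> (m <= n)%N ->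
  power_image T n M `<=` power_image T m M.
Proof.
move=> iM mn _ [x Mx <-]; exists (iter (n - m) T x); first exact: invariant_iter.
by rewrite -iterD subnKC.
Qed.

Section Powers.
Variables (T : X -> X) (M : set X).
Hypotheses (lT : linear T) (sM : lin_subspace M) (iM : invariant T M).
Local Notation Mp n := (power_image T n M).
Let sp n : lin_subspace (Mp n). Proof. exact: lin_subspace_power. Qed.
Let ip n : invariant T (Mp n). Proof. exact: invariant_power. Qed.

Lemma fin_ker_power m n : (m <= n)%N -> fin_ker T (Mp m) -> fin_ker T (Mp n).
Proof.
move=> /subnKC <-; elim: (n - m)%N => [|k IH]; rewrite ?addn0 // addnS => /IH h.
by rewrite power_imageS; apply: fin_ker_image.
Qed.

Lemma fin_coker_power m n : (m <= n)%N -> fin_coker T (Mp m) -> fin_coker T (Mp n).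
Proof.
move=> /subnKC <-; elim: (n - m)%N => [|k IH]; rewrite ?addn0 // addnS => /IH h.
by rewrite power_imageS; apply: fin_coker_image.
Qed.

Lemma fin_coker_descent m n : fin_ker T (Mp m) -> fin_coker T (Mp n) -> fin_coker T (Mp m).
Proof.
move=> fa fb; have [nm|/ltnW mn] := leqP n m; first exact: fin_coker_power fb.
have: fin_coker T (Mp (m + (n - m))) by rewrite subnKC.
elim: (n - m)%N => [|k IH]; rewrite ?addn0 // addnS power_imageS => h.
apply: IH; apply: fin_coker_preimage => //.
by apply: fin_ker_power fa; apply: leq_addr.
Qed.

Lemma fin_ker_descent m n : fin_coker T (Mp m) -> fin_ker T (Mp n) -> fin_ker T (Mp m).
Proof.
move=> fb fa; have [nm|/ltnW mn] := leqP n m; first exact: fin_ker_power fa.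
have: fin_ker T (Mp (m + (n - m))) by rewrite subnKC.
elim: (n - m)%N => [|k IH]; rewrite ?addn0 // addnS power_imageS => h.
apply: IH; apply: fin_ker_preimage => //.
by apply: fin_coker_power fb; apply: leq_addr.
Qed.

Lemma has_index_power n a b : has_index T M a b ->
  exists a' b', has_index T (Mp n) a' b' /\ (a + b' = a' + b)%N.
Proof.
move=> hab; elim: n => [|n [a' [b' [h E]]]].
  by exists a, b; rewrite power_image0.
have [a2 [b2 [h2 E2]]] := has_index_image lT (sp n) (@ip n) h.
by exists a2, b2; rewrite power_imageS; split=> //; lia.
Qed.

End Powers.

Lemma power_image_addset T n M N : linear T ->
  power_image T n (addset M N) = addset (power_image T n M) (power_image T n N).
Proof.
move=> lT; have lTn := linear_iter n lT; apply/seteqP; split.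
  move=> _ [_ /addsetP[u [v [Mu Nv ->]]] <-]; apply/addsetP.
  by exists (iter n T u), (iter n T v); rewrite (linD _ _ lTn); split=> //; [exists u|exists v].
move=> _ /addsetP[_ [_ [[u Mu <-] [v Nv <-] ->]]].
exists (u + v); last by rewrite (linD _ _ lTn).
by apply/addsetP; exists u, v.
Qed.

Lemma image_addset T M N : linear T -> T @` addset M N = addset (T @` M) (T @` N).
Proof. exact: (@power_image_addset T 1). Qed.

Lemma direct_eq M N u v u' v' : lin_subspace M -> lin_subspace N ->
  M `&` N `<=` [set 0] -> M u -> M u' -> N v -> N v' -> u + v = u' + v' ->
  u = u' /\ v = v'.
Proof.
move=> sM sN MN Mu Mu' Nv Nv' E.
have uv : u - u' = v' - v.
  by have -> : u = u' + v' - v; [rewrite -E addrK|lmod].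
have u0 : u - u' = 0.
  by apply: MN; split; [exact: subspaceB|rewrite uv; exact: subspaceB].
split; apply/eqP; first by rewrite -subr_eq0 u0.
by rewrite eq_sym -subr_eq0 -uv u0.
Qed.

Lemma hasdim_direct U1 U2 V1 V2 m n : lin_subspace U1 -> lin_subspace U2 ->
  lin_subspace V1 -> lin_subspace V2 -> V1 `<=` U1 -> V2 `<=` U2 ->
  U1 `&` U2 `<=` [set 0] -> hasdim U1 V1 m -> hasdim U2 V2 n ->
  hasdim (addset U1 U2) (addset V1 V2) (n + m).
Proof.
move=> sU1 sU2 sV1 sV2 VU1 VU2 U12 h1 h2.
have sA := lin_subspaceD sU1 sU2; have sB := lin_subspaceD sU1 sV2.
have sD := lin_subspaceD sV1 sV2.
apply: (hasdim_add sA sB sD).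
- by move=> _ /addsetP[u [v [/VU1 ? ? ->]]]; apply/addsetP; exists u, v.
- by move=> _ /addsetP[u [v [? /VU2 ? ->]]]; apply/addsetP; exists u, v.
- suff [hh _] : hasdim U2 V2 n <-> hasdim (addset U1 U2) (addset U1 V2) n by exact: hh.
  apply: (@hasdim_iso _ _ id) => //.
  + by move=> x; apply: addsetr.
  + move=> _ /addsetP[u [v [Uu Uv ->]]]; exists v => //.
    by rewrite addrK; apply: addsetl.
  + move=> x Ux; split; first exact: addsetr.
    move=> /addsetP[u [v [Uu Vv xE]]].
    have E : 0 + x = u + v by rewrite add0r.
    by have [_ ->] := direct_eq sU1 sU2 U12 (subspace0 sU1) Uu Ux (VU2 _ Vv) E.
- suff [hh _] : hasdim U1 V1 m <-> hasdim (addset U1 V2) (addset V1 V2) m by exact: hh.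
  apply: (@hasdim_iso _ _ id) => //.
  + by move=> x; apply: addsetl.
  + move=> _ /addsetP[u [v [Uu Uv ->]]]; exists u => //.
    by rewrite addrAC subrr add0r; apply: addsetr.
  + move=> x Ux; split; first exact: addsetl.
    move=> /addsetP[u [v [Vu Vv xE]]].
    have E : x + 0 = u + v by rewrite addr0.
    by have [-> _] := direct_eq sU1 sU2 U12 Ux (VU1 _ Vu) (subspace0 sU2) (VU2 _ Vv) E.
Qed.

Section DirectSum.
Variables (T : X -> X) (M N : set X).
Hypotheses (lT : linear T) (sM : lin_subspace M) (sN : lin_subspace N).
Hypotheses (iM : invariant T M) (iN : invariant T N) (MN : M `&` N `<=` [set 0]).
Let K := ker T.
Let sK : lin_subspace K. Proof. exact: lin_subspace_ker. Qed.
Let sTM : lin_subspace (T @` M). Proof. exact: lin_subspace_image. Qed.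
Let sTN : lin_subspace (T @` N). Proof. exact: lin_subspace_image. Qed.
Let sMK : lin_subspace (M `&` K). Proof. exact: lin_subspaceI. Qed.
Let sNK : lin_subspace (N `&` K). Proof. exact: lin_subspaceI. Qed.
Let sMN : lin_subspace (addset M N). Proof. exact: lin_subspaceD. Qed.

Let ker_direct : addset M N `&` K = addset (M `&` K) (N `&` K).
Proof.
apply/seteqP; split=> x.
  move=> [/addsetP[u [v [Mu Nv ->]]] E].
  have E' : T u + T v = 0 + 0 by rewrite -(linD _ _ lT) addr0; exact: E.
  have [hu hv] := direct_eq sM sN MN (iM Mu) (subspace0 sM) (iN Nv) (subspace0 sN) E'.
  by apply/addsetP; exists u, v.
move=> /addsetP[u [v [[Mu Ku] [Nv Kv] ->]]]; split; last exact: subspaceD.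
by apply/addsetP; exists u, v.
Qed.

Lemma has_index_direct a b a' b' : has_index T M a b -> has_index T N a' b' ->
  has_index T (addset M N) (a' + a) (b' + b).
Proof.
move=> [ha hb] [ha' hb']; split.
  rewrite -/K ker_direct.
  have -> : [set 0] = addset [set 0] [set 0] :> set X.
    apply/seteqP; split=> [_ ->|_ /addsetP[_ [_ [-> -> ->]]]] /=; last by rewrite addr0.
    by apply/addsetP; exists 0, 0; rewrite addr0.
  apply: hasdim_direct ha ha' => //; try exact: lin_subspace0.
  - by move=> _ ->; apply: subspace0.
  - by move=> _ ->; apply: subspace0.
  - by move=> x [[Mx _] [Nx _]]; apply: MN.
by rewrite image_addset //; apply: hasdim_direct hb hb' => //; apply: invariant_image.
Qed.

Lemma fin_ker_directl : fin_ker T (addset M N) -> fin_ker T M.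
Proof.
apply: fin_sub => //; try exact: lin_subspace0; first exact: lin_subspaceI.
by apply: setSI; apply: addsetl.
Qed.

Lemma fin_coker_directl : fin_coker T (addset M N) -> fin_coker T M.
Proof.
rewrite /fin_coker image_addset // => h.
have sV : lin_subspace (addset (T @` M) (T @` N)) by exact: lin_subspaceD.
have VMN : addset (T @` M) (T @` N) `<=` addset M N.
  by rewrite -image_addset //; apply: invariant_image => _ /addsetP[u [v [Mu Nv ->]]];
    rewrite (linD _ _ lT); apply/addsetP; exists (T u), (T v); split; [exact: iM|exact: iN|].
have [n] : fin (addset M (addset (T @` M) (T @` N))) (addset (T @` M) (T @` N)).
  apply: (fin_sub sMN sV) => //; first exact: lin_subspaceD.
  by apply: addset_sub => //; apply: addsetl.
rewrite -hasdim_iso2 // => hn; exists n.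
rewrite (_ : T @` M = M `&` addset (T @` M) (T @` N)) //.
apply/seteqP; split=> x.
  by move=> [y My <-]; split; [exact: iM|apply: addsetl => //; exists y].
move=> [Mx /addsetP[_ [_ [[u Mu <-] [v Nv <-] E]]]]; exists u => //.
rewrite -[x]addr0 in E.
by have [-> _] := direct_eq sM sN MN Mx (iM Mu) (subspace0 sN) (iN Nv) E.
Qed.

End DirectSum.

Lemma addsetC M N : addset M N = addset N M.
Proof.
by apply/seteqP; split=> _ /addsetP[u [v [? ? ->]]]; apply/addsetP; exists v, u;
  rewrite addrC.
Qed.

(** The quotients [T ^ j N / T ^ (j + 1) N] are all finite dimensional, and the last
    term of the filtration is 0. *)
Lemma fin_nilpotent T N : linear T -> lin_subspace N -> invariant T N ->
  nilpotent T N -> fin_coker T N -> fin N [set 0].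
Proof.
move=> lT sN iN [k nil] fb.
have h j : fin N (power_image T j N).
  elim: j => [|j IH]; first by rewrite power_image0; exists 0%N; apply: hasdim_refl.
  apply: (fin_trans sN (lin_subspace_power j lT sN)) IH _.
  - exact: lin_subspace_power.
  - exact: power_image_le.
  - by rewrite -{2}(power_image0 T N); apply: power_image_le.
  - rewrite power_imageS; apply: (fin_coker_power lT sN iN (leq0n j)).
    by rewrite power_image0.
have := h k; congr fin; apply/seteqP; split=> [_ [x Nx <-]|_ ->] /=; first exact: nil.
exact: subspace0 (lin_subspace_power k lT sN).
Qed.

(** The index is read off any subspace of finite codimension on which [A] is
    injective: [Y / W] and [Y / A W] exceed the kernel and the cokernel of [A] by the
    same dimension, that of [Y / (W + ker A)]. *)
Lemma has_index_restrict A Y W a b : linear A -> lin_subspace Y -> lin_subspace W ->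
  invariant A Y -> W `<=` Y -> W `&` ker A `<=` [set 0] ->
  hasdim Y W a -> hasdim Y (A @` W) b ->
  exists p q, has_index A Y p q /\ (p + b = q + a)%N.
Proof.
move=> lA sY sW iY WY W0 ha hb.
have sK : lin_subspace (Y `&` ker A).
  by apply: lin_subspaceI => //; apply: lin_subspace_ker.
have sKW := lin_subspaceD sK sW.
have sAY := lin_subspace_image lA sY; have sAW := lin_subspace_image lA sW.
have KWY : addset (Y `&` ker A) W `<=` Y by apply: addset_sub => // x [].
have [m [c [hm hc ->]]] := hasdim_split sY sKW sW (addsetr sK (V:=W)) KWY ha.
have [q [m' [hq hm' ->]]] := hasdim_split sY sAY sAW (image_subset A WY) (invariant_image iY) hb.
have mm : m = m'.
  apply: (hasdim_uniq sY sKW hm).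
  suff [_ hh] : hasdim Y (addset (Y `&` ker A) W) m' <-> hasdim (A @` Y) (A @` W) m'.
    exact: hh.
  apply: (@hasdim_iso _ _ A) => //.
  - by move=> _ [x Yx <-]; exists x => //; rewrite subrr; apply: subspace0.
  - move=> x Yx; split.
      move=> /addsetP[k [w [[_ Kk] Ww ->]]]; exists w => //.
      by rewrite (linD _ _ lA) (Kk : A k = 0) add0r.
    move=> [w Ww E]; apply/addsetP; exists (x - w), w; split=> //; last by rewrite subrK.
    split; first by apply: subspaceB => //; apply: WY.
    by rewrite /ker /= (linB _ _ lA) E subrr.
exists c, q; split; last by rewrite mm; lia.
split=> //; move: hc; rewrite -hasdim_iso2 // (_ : _ `&` _ `&` W = [set 0]) //.
apply/seteqP; split=> [x [[_ Kx] Wx]|_ ->]; first exact: W0.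
by split; apply: subspace0.
Qed.

(** The nilpotent summand is finite dimensional, so that [has_index_restrict]
    applies to the other one, which [A] maps onto itself. *)
Lemma index_bijective_nilpotent A Y P Q p q : linear A -> lin_subspace P -> lin_subspace Q ->
  invariant A P -> invariant A Q -> Y = addset P Q -> P `&` Q `<=` [set 0] ->
  A @` P = P -> P `&` ker A `<=` [set 0] -> nilpotent A Q ->
  has_index A Y p q -> p = q.
Proof.
move=> lA sP sQ iP iQ -> PQ AP P0 nil hpq.
have sY := lin_subspaceD sP sQ.
have [n hn] : fin Q [set 0].
  apply: (fin_nilpotent lA) => //; apply: (@fin_coker_directl A Q P) => //.
    by rewrite setIC.
  by rewrite addsetC; exists q; case: hpq.
have ha : hasdim (addset P Q) P n.
  rewrite addsetC -hasdim_iso2 // (_ : Q `&` P = [set 0]) //.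
  apply/seteqP; split=> [x [? ?]|_ ->]; first by apply: PQ.
  by split; apply: subspace0.
have hb : hasdim (addset P Q) (A @` P) n by rewrite AP.
have iY : invariant A (addset P Q).
  move=> _ /addsetP[u [v [Pu Qv ->]]]; rewrite (linD _ _ lA).
  by apply/addsetP; exists (A u), (A v); split; [exact: iP|exact: iQ|].
have [p' [q' [h E]]] := has_index_restrict lA sY sP iY (addsetl sQ (U:=P)) P0 ha hb.
have [-> ->] := has_index_uniq lA sY hpq h; lia.
Qed.

End AlgebraicIndex.

(** * Stability of the index *)

Section Stability.
Context {R : realType} {X : completeNormedModType R[i]}.
Implicit Types (S T A : X -> X) (F U V W Y M N P Q : set X).
Local Notation C := R[i].

Lemma closed_ker S : linear S -> bounded_op S -> closed (ker S).
Proof.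
move=> lS [L L0 hL]; apply/closed_rnormP => x hx; apply: rnorm_small => e e0.
have L1 : 0 < L + 1 by rewrite ltr_wpDl.
have [y Sy] := hx (e / (L + 1)) (divr_gt0 e0 L1).
rewrite ltr_pdivlMr // mulrC; apply: le_lt_trans.
have -> : S x = S (x - y) by rewrite (linB _ _ lS) (Sy : S y = 0) subr0.
by apply: le_trans (hL _) _; rewrite ler_wpM2r ?rnorm_ge0 // lerDl.
Qed.

Lemma linear_comp S S' : linear S -> linear S' -> linear (S \o S').
Proof. by move=> lS lS' a u v /=; rewrite lS' lS. Qed.

(** For small [l], with [W] a complement of the kernel and [F] one of the range,
    [T - l] is still injective on [W] and [(T - l) W] is still a complement of
    [F]; so the index of [T - l] is that of [T].  It is 0 when [T - l] is the sum
    of a bijection and a nilpotent operator. *)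
Lemma index_meromorphic T Y a b : linear T -> bounded_op T -> lin_subspace Y ->
  closed Y -> invariant T Y -> has_index T Y a b ->
  (forall l : C, l != 0 -> let A := fun x => T x - l *: x in
    exists P Q, [/\ lin_subspace P, lin_subspace Q, invariant A P & invariant A Q] /\
      [/\ Y = addset P Q, P `&` Q `<=` [set 0], A @` P = P,
          P `&` ker A `<=` [set 0] & nilpotent A Q]) ->
  a = b.
Proof.
move=> lT bT sY cY iY hab hdec; have [ha hb] := hab.
have sTY := lin_subspace_image lT sY; have TYY := invariant_image iY.
have sK : lin_subspace (Y `&` ker T).
  by apply: lin_subspaceI => //; apply: lin_subspace_ker.
have finK : fin (Y `&` ker T) [set 0] by exists a.
have [p [lp bp pK pid]] := bounded_projection sK finK.
pose W := Y `&` ker p.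
have sW : lin_subspace W by apply: lin_subspaceI => //; apply: lin_subspace_ker.
have cW : closed W by apply: closedI => //; apply: closed_ker.
have [F [sF FY hF F0 dec]] := fin_complement sY sTY TYY hb.
have cF : closed F by apply: closed_fin0 => //; exists b.
have pp x : p (x - p x) = 0 by rewrite (linB _ _ lp) (pid (p x)) ?subrr.
have [w f [Yw _] Ff||c c0 hc] := open_mapping lT bT sW cW sF cF sY cY.
- by apply: subspaceD => //; [apply: iY|apply: FY].
- move=> y /dec[f Ff [x Yx xy]]; exists (x - p x), f.
  have [Ypx Tpx] := pK x.
  split=> //; first by split; [exact: subspaceB|exact: pp].
  by rewrite (linB _ _ lT) (Tpx : T (p x) = 0) subr0 xy subrK.
have uniq w f : W w -> F f -> T w + f = 0 -> w = 0 /\ f = 0.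
  move=> [Yw pw] Ff E.
  have f0 : f = 0.
    apply: F0 => //; exists (- w); first exact: subspaceN.
    by rewrite -[- w]sub0r (linB _ _ lT) (lin0 lT) -E; lmod.
  split=> //; rewrite -(pid w) //; split=> //.
  by move: E; rewrite f0 addr0.
(* For this [l] the term [l w] is at most half of [y] when [w] is the component in
   [W] of the solution of [y = T w + f]. *)
pose l : R := (2 * (c + 1))^-1.
have l0 : 0 < l by rewrite invr_gt0 mulr_gt0 // ltr_wpDl.
have lc : c * l <= 2^-1.
  rewrite /l invfM mulrCA mulrC ler_piMl // ler_pdivrMr ?mul1r ?lerDl //.
  by rewrite ltr_wpDl.
have nl x : rnorm (l%:C%C *: x) = l * rnorm x.
  by rewrite rnormZ Re_norm_real gtr0_norm.
pose A x := T x - l%:C%C *: x.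
have lA : linear A by apply: linear_shift.
have bA : bounded_op A.
  rewrite (_ : A = fun x => T x + (- l%:C%C) *: x).
    by apply: bounded_opD => //; apply/bounded_opZ/bounded_op_id.
  by apply/funext => x; rewrite scaleNr.
have iA : invariant A Y by move=> x Yx; apply: subspaceB => //; [apply: iY|apply: subspaceZ].
have inj w f : W w -> F f -> A w + f = 0 -> w = 0 /\ f = 0.
  move=> Ww Ff E; have [Yw _] := Ww.
  have [w' [f' [Ww' Ff' E' nw' _]]] := hc _ (subspaceZ l%:C%C sY Yw).
  have [/eqP] : w - w' = 0 /\ f - f' = 0.
    apply: uniq; [exact: subspaceB|exact: subspaceB|].
    have -> : T (w - w') + (f - f') = (A w + f) + (l%:C%C *: w - (T w' + f')).
      by rewrite /A (linB _ _ lT); lmod.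
    by rewrite E E' subrr addr0.
  rewrite subr_eq0 => /eqP ww _; rewrite -ww nl mulrA in nw'.
  have w0 : w = 0.
    apply: rnorm_eq0; apply/eqP; rewrite eq_le rnorm_ge0 andbT.
    have := ler_wpM2r (rnorm_ge0 w) lc; lra.
  by split=> //; move: E; rewrite w0 (lin0 lA) add0r.
have sur z : Y z -> exists w f, [/\ W w, F f & z = A w + f].
  move=> Yz.
  have [|w [f [Ww Ff E _ _]]] := @approx_solve _ _ A W F Y c lA bA sW cW sF cF c0 _ z Yz.
    move=> y Yy; have [w [f [Ww Ff E nw nf]]] := hc y Yy.
    have E' : y - (A w + f) = l%:C%C *: w by rewrite /A E; lmod.
    exists w, f; split=> //; first by rewrite E'; apply: subspaceZ => //; case: Ww.
    split=> //; rewrite E' nl.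
    have := ler_wpM2l (ltW l0) nw; have := ler_wpM2r (rnorm_ge0 y) lc; lra.
  by exists w, f.
have hW : hasdim Y W a.
  suff [_ hh] : hasdim Y W a <-> hasdim (Y `&` ker T) [set 0] a by exact: hh.
  apply: (@hasdim_iso _ _ p) => //.
  - exact: lin_subspace0.
  - by move=> y Ky; exists y; [case: Ky|rewrite (pid y) //= subrr].
  - by move=> x Yx; split=> [[]|].
  - by move=> x [].
have hAW : hasdim Y (A @` W) b.
  suff [hh _] : hasdim F [set 0] b <-> hasdim Y (A @` W) b by exact: hh.
  apply: (@hasdim_iso _ _ id) => //.
  - exact: lin_subspace0.
  - exact: lin_subspace_image.
  - by move=> y /sur[w [f [Ww Ff ->]]]; exists f => //; exists w; rewrite // addrK.
  - move=> f Ff; split=> [->|[w Ww E]]; first exact: subspace0 (lin_subspace_image lA sW).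
    have [] // := inj (- w) f (subspaceN sW Ww) Ff _.
    by rewrite -[- w]sub0r (linB _ _ lA) (lin0 lA) E; lmod.
  - by move=> _ ->; apply: subspace0.
have W0 : W `&` ker A `<=` [set 0].
  move=> w [Ww Aw]; have [] // := inj w 0 Ww (subspace0 sF) _.
  by rewrite addr0; exact: Aw.
have WY : W `<=` Y by move=> w [].
have [p' [q' [h E]]] := has_index_restrict lA sY sW iA WY W0 hW hAW.
have l0' : l%:C%C != 0 :> C by rewrite fmorph_eq0 gt_eqF.
have [P [Q [[sP sQ iP iQ] [EY PQ AP P0 nil]]]] := hdec _ l0'.
have := index_bijective_nilpotent lA sP sQ iP iQ EY PQ AP P0 nil h.
by move=> pq; move: E; rewrite pq => /addnI.
Qed.

End Stability.

(** * Splitting a B-Fredholm operator *)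

Section Decomposition.
Context {R : realType} {X : completeNormedModType R[i]}.
Implicit Types (S T A : X -> X) (F U V W Y M N P Q : set X).
Local Notation C := R[i].

Lemma fin_addset M N : lin_subspace M -> lin_subspace N -> fin N [set 0] ->
  fin (addset M N) M.
Proof.
move=> sM sN fN; have [n] : fin N (N `&` M).
  apply: (fin_sub sN lin_subspace0 sN) => //; first exact: lin_subspaceI.
  by move=> _ ->; split; apply: subspace0.
by rewrite hasdim_iso2 // addsetC => hn; exists n.
Qed.

Lemma fin_image S U V : linear S -> lin_subspace U -> lin_subspace V ->
  fin U V -> fin (S @` U) (S @` V).
Proof.
move=> lS sU sV [n [e /basis_modP[//|//|_ sp _]]].
have [||_ [x /sp[c hc] <-]|k _ hk] := @fin_of_span _ _ (S @` U) (S @` V) n (fun j => S (e j)).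
- exact: lin_subspace_image.
- exact: lin_subspace_image.
- by exists c; rewrite -(lin_sum _ _ lS) -(linB _ _ lS); exists (x - \sum_j c j *: e j).
- by exists k.
Qed.

Lemma closed_power T Y m n : linear T -> bounded_op T -> lin_subspace Y ->
  invariant T Y -> closed (power_image T m Y) -> fin_coker T (power_image T m Y) ->
  (m <= n)%N -> closed (power_image T n Y).
Proof.
move=> lT bT sY iY cY fY /subnKC <-; elim: (n - m)%N => [|k IH]; first by rewrite addn0.
rewrite addnS power_imageS.
apply: (closed_image lT bT (lin_subspace_power _ lT sY) IH).
  by apply: invariant_image; apply: invariant_power.
by apply: fin_coker_power fY => //; apply: leq_addr.
Qed.

(** The index [d] achieves the least dimension of [N(T) `&` R(T ^ m)] for [m >= p]. *)
Lemma stable_kernel T p : linear T -> fin_ker T (power_image T p setT) ->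
  exists2 d, (p <= d)%N & forall m, (d <= m)%N ->
    power_image T d setT `&` ker T `<=` power_image T m setT.
Proof.
move=> lT [n0 h0]; pose I m := power_image T m [set: X] `&` ker T.
have sI m : lin_subspace (I m).
  apply: lin_subspaceI; last exact: lin_subspace_ker.
  exact: (lin_subspace_power _ lT lin_subspaceT).
have exP : exists n, `[< exists2 m, (p <= m)%N & hasdim (I m) [set 0] n >].
  by exists n0; apply/asboolP; exists p.
case: (ex_minnP exP) => n /asboolP[d pd hd] minn; exists d => // m dm.
have ImId : I m `<=` I d.
  by apply: setSI; apply: power_image_le.
have set0I : [set 0] `<=` I m by move=> _ ->; apply: subspace0.
have [x [y [hx hy E]]] := hasdim_split (sI d) (sI m) lin_subspace0 set0I ImId hd.
have ny : (n <= y)%N by apply: minn; apply/asboolP; exists m => //; apply: leq_trans dm.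
have x0 : x = 0%N by lia.
by rewrite x0 in hx => z /(hasdim0 (sI d) (sI m) hx)[].
Qed.

Section Splitting.
Variables (T : X -> X) (d : nat).
Hypotheses (lT : linear T) (bT : bounded_op T).
Local Notation Rg n := (power_image T n [set: X]).
Hypotheses (fker : fin_ker T (Rg d)) (fcok : fin_coker T (Rg d)) (cRd : closed (Rg d)).
Hypothesis stable : forall m, (d <= m)%N -> Rg d `&` ker T `<=` Rg m.

Let sR n : lin_subspace (Rg n).
Proof. exact: (lin_subspace_power _ lT lin_subspaceT). Qed.
Let Rle m n : (m <= n)%N -> Rg n `<=` Rg m.
Proof. exact: power_image_le. Qed.
Let lTn n : linear (iter n T). Proof. exact: linear_iter. Qed.
Let bTn n : bounded_op (iter n T). Proof. exact: bounded_op_iter. Qed.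
Let iterT0 n : iter n T 0 = 0. Proof. exact: lin0. Qed.
Let iterT_ge m n x : (m <= n)%N -> iter m T x = 0 -> iter n T x = 0.
Proof. by move=> mn h; rewrite -(subnK mn) iterD h iterT0. Qed.

(** By stability [T ^ j x] is in the range of [T ^ (j + d + m)]; so [x] differs from
    an element of the range of [T ^ (d + m)] by a vector killed by [T ^ j]. *)
Lemma range_nilpotent j x m : Rg d x -> iter j T x = 0 -> Rg m x.
Proof.
elim: j x => [|j IH] x Rx; first by move=> /= ->; apply: subspace0.
move=> h.
have hK : (Rg d `&` ker T) (iter j T x).
  by split; [exact: invariant_iter (invariant_power _) Rx|exact: h].
have [|z _ E] := @stable (j + (d + m)) _ _ hK; first by lia.
pose y := iter (d + m) T z.
have Ry n : (n <= d + m)%N -> Rg n y by move=> nm; apply: (Rle nm); exists z.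
rewrite -(subrK y x); apply: subspaceD => //; last by apply: Ry; lia.
apply: IH; first by apply: subspaceB => //; apply: Ry; lia.
by rewrite (linB _ _ (lTn j)) -E iterD subrr.
Qed.

Let V := ker (iter d T).
Let sV : lin_subspace V. Proof. exact: lin_subspace_ker. Qed.
Let L := addset (T @` [set: X]) V.
Let sTX : lin_subspace (T @` [set: X]). Proof. exact: (lin_subspace_image lT lin_subspaceT). Qed.
Let sL : lin_subspace L. Proof. exact: lin_subspaceD. Qed.

(** [T ^ d x] is in the range of [T ^ (d + 1)] by [range_nilpotent]. *)
Lemma nilpotent_range m x : iter m T x = 0 -> L x.
Proof.
move=> h.
have [||z _ E] := @range_nilpotent m (iter d T x) d.+1.
- by exists x.
- by rewrite -iterD addnC iterD h iterT0.
apply/addsetP; exists (T z), (x - T z); split; [by exists z| |by rewrite addrC subrK].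
by rewrite /V /ker /= (linB _ _ (lTn d)) -E -iterSr subrr.
Qed.

Section NilpotentPart.
Variable pi : X -> X.
Hypotheses (lpi : linear pi) (bpi : bounded_op pi).
Hypotheses (piK : forall x, (Rg d `&` ker T) (pi x))
  (piid : forall x, (Rg d `&` ker T) x -> pi x = x).

(** A [T]-invariant complement of [N(T ^ d) `&` R(T ^ d)] in [N(T ^ d)]. *)
Definition nil_part : set X := [set x | V x /\ forall k, pi (iter k T x) = 0].

Lemma lin_subspace_nil_part : lin_subspace nil_part.
Proof.
apply/lin_subspaceP; split; first by split=> [|k]; [exact: subspace0|rewrite iterT0 lin0].
move=> a u v [Vu hu] [Vv hv]; split=> [|k]; first by apply: subspaceD => //; apply: subspaceZ.
by rewrite (lTn k) lpi hu hv scaler0 addr0.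
Qed.

Lemma closed_nil_part : closed nil_part.
Proof.
apply/closed_rnormP => x hx; split=> [|k].
  apply: (closed_rnormP V).1 => [|e /hx[y [Vy _]]]; last by exists y.
  exact: closed_ker.
have lk := linear_comp lpi (lTn k).
apply: (closed_rnormP (ker (pi \o iter k T))).1 => [|e /hx[y [_ hy]] xy].
  exact: closed_ker lk (bounded_op_comp bpi (bTn k)).
by exists y => //; exact: hy.
Qed.

Lemma invariant_nil_part : invariant T nil_part.
Proof.
move=> x [Vx hx]; split=> [|k]; last by rewrite -iterSr.
by rewrite /V /ker /= -iterSr iterS (Vx : iter d T x = 0) lin0.
Qed.

(** The last nonzero [T ^ j x] would be in [N(T) `&` R(T ^ d)], where [pi] is the
    identity. *)
Lemma nil_part_range : nil_part `&` Rg d `<=` [set 0].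
Proof.
move=> x [[Vx hx] Rx].
have: iter d T x = 0 := Vx.
elim: (d) => //= j IH h; apply: IH; rewrite -(hx j) piid //.
by split; [exact: invariant_iter (invariant_power _) Rx|exact: h].
Qed.

(** The components of [v] along the iterated preimages of [N(T) `&` R(T ^ d)] are
    removed one at a time, starting from the deepest. *)
Lemma nil_part_complement v : V v -> exists2 w, Rg d w & nil_part (v - w).
Proof.
move=> Vv.
have h j : (j <= d)%N -> exists w, [/\ Rg d w, V w &
    forall k, (d - j <= k)%N -> pi (iter k T (v - w)) = 0].
  elim: j => [|j IH] jd.
    exists 0; split; [exact: subspace0|exact: subspace0|move=> k].
    by rewrite subn0 subr0 => dk; rewrite (iterT_ge dk Vv) lin0.
  have [w [Rw Vw hw]] := IH (ltnW jd).
  pose i := (d - j.+1)%N; pose u := pi (iter i T (v - w)).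
  have [Ru Ku] : (Rg d `&` ker T) u by apply: piK.
  have [z _ E] := @range_nilpotent 1 u (i + d) Ru Ku.
  pose y := iter d T z.
  have Ey : iter i T y = u by rewrite -E iterD.
  have Ey1 : iter i.+1 T y = 0 by rewrite iterS Ey.
  have Vy : V y by apply: iterT_ge Ey1; rewrite /i; lia.
  exists (w + y); split.
  - by apply: subspaceD => //; exists z.
  - exact: subspaceD.
  - move=> k; rewrite leq_eqVlt opprD addrA => /orP[/eqP <-|ik].
      by rewrite -/i (linB _ _ (lTn i)) Ey (linB _ _ lpi) (piid (conj Ru Ku)) subrr.
    rewrite (linB _ _ (lTn k)) (iterT_ge _ Ey1) // subr0; apply: hw; lia.
have [w [Rw Vw hw]] := h d (leqnn d).
exists w => //; split=> [|k]; first exact: subspaceB.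
by apply: hw; rewrite subnn.
Qed.

End NilpotentPart.

Section FredholmPart.
Variable G : set X.
Hypotheses (sG : lin_subspace G) (fG : fin G [set 0]).
Hypotheses (GL : forall x, G x -> L x -> x = 0)
  (Gdec : forall x, exists2 g, G g & L (x - g)).

(** This is [G + T G + ... + T ^ (j - 1) G + R(T ^ j)]; in contrast with [X], all its
    vectors killed by a power of [T] are in [R(T ^ j)]. *)
Fixpoint fred_part (j : nat) : set X :=
  if j is k.+1 then addset (T @` fred_part k) G else setT.

Lemma lin_subspace_fred_part j : lin_subspace (fred_part j).
Proof.
elim: j => [|j IH] /=; first exact: lin_subspaceT.
by apply: lin_subspaceD => //; apply: lin_subspace_image.
Qed.

Lemma fred_part_decr j : fred_part j.+1 `<=` fred_part j.
Proof.
elim: j => [|j IH] // x /addsetP[_ [g [[y Qy <-] Gg ->]]].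
by apply/addsetP; exists (T y), g; split=> //; exists y => //; apply: IH.
Qed.

Lemma invariant_fred_part j : invariant T (fred_part j).
Proof.
move=> x Qx; apply: fred_part_decr; apply/addsetP; exists (T x), 0.
by rewrite addr0; split=> //; exact: subspace0.
Qed.

Lemma range_fred_part j : Rg j `<=` fred_part j.
Proof.
elim: j => [|j IH] // x; rewrite power_imageS => -[y Ry <-].
by apply: addsetl => //; exists y => //; apply: IH.
Qed.

(** If [x = T y + g], then [g] is in [L] by [nilpotent_range], so [g = 0] and the
    claim is reduced to [y], which is killed by [T ^ (m + 1)]. *)
Lemma fred_part_nilpotent j m x : fred_part j x -> iter m T x = 0 -> Rg j x.
Proof.
elim: j m x => [|j IH] m x; first by rewrite power_image0.
move=> /addsetP[_ [g [[y Qy <-] Gg ->]]] h.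
have Lg : L g.
  rewrite -(addKr (T y) g) addrC; apply: subspaceB => //; first exact: nilpotent_range h.
  by apply: addsetl => //; exists y.
rewrite (GL Gg Lg) addr0 in h *.
rewrite power_imageS; exists y => //; apply: (IH m.+1) => //.
by rewrite iterSr.
Qed.

(** The equation [X = T X + N(T ^ d) + G], substituted [j] times into itself. *)
Lemma fred_part_span j x : exists2 q, fred_part j q & V (x - q).
Proof.
elim: j x => [|j IH] x; first by exists x; rewrite // subrr; apply: subspace0.
have [g Gg /addsetP[_ [v [[a _ <-] Vv E]]]] := Gdec x.
have [q Qq Vq] := IH a.
exists (T q + g); first by apply/addsetP; exists (T q), g; split=> //; exists q.
have -> : x - (T q + g) = T (a - q) + v.
  have -> : x = T a + v + g by rewrite -E subrK.
  by rewrite (linB _ _ lT); lmod.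
apply: subspaceD => //; rewrite /V /ker /= -iterSr iterS (Vq : iter d T (a - q) = 0).
exact: lin0.
Qed.

Lemma fin_fred_part j : fin (fred_part j) (Rg j).
Proof.
elim: j => [|j IH].
  exists 0%N; apply: hasdim_refl => //; first exact: lin_subspaceT.
  by rewrite power_image0.
have sT := lin_subspace_image lT (lin_subspace_fred_part j).
apply: (fin_trans (lin_subspace_fred_part j.+1) sT (sR j.+1)).
- by rewrite power_imageS; apply: image_subset; apply: range_fred_part.
- exact: addsetl.
- exact: fin_addset.
- by rewrite power_imageS; apply: fin_image => //; apply: lin_subspace_fred_part.
Qed.

End FredholmPart.

Theorem fredholm_nilpotent_splitting : exists M N,
  [/\ Red T setT M N, fin_ker T M, fin_coker T M, closed (T @` M) & nilpotent T N].
Proof.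
have sK : lin_subspace (Rg d `&` ker T).
  by apply: lin_subspaceI => //; apply: lin_subspace_ker.
have [pi [lpi bpi piK piid]] := bounded_projection sK fker.
have [n hn] : fin [set: X] L.
  have [n hn] := fcok; exists n.
  suff [_ hh] : hasdim [set: X] L n <-> hasdim (Rg d) (T @` Rg d) n by exact: hh.
  apply: (@hasdim_iso _ _ (iter d T)) => //.
  - exact: lin_subspaceT.
  - exact: lin_subspace_image.
  - by move=> x _; exists x.
  - by move=> _ [x _ <-]; exists x => //; rewrite subrr; apply: subspace0 (lin_subspace_image _ _).
  - move=> x _; split.
      move=> /addsetP[_ [v [[z _ <-] Vv ->]]]; exists (iter d T z); first by exists z.
      by rewrite (linD _ _ (lTn d)) (Vv : iter d T v = 0) addr0 -iterSr.
    move=> [_ [z _ <-] E]; apply/addsetP; exists (T z), (x - T z).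
    split; [by exists z| |by rewrite addrC subrK].
    by rewrite /V /ker /= (linB _ _ (lTn d)) -E -iterSr subrr.
have [G [sG _ hG GL Gdec]] := fin_complement lin_subspaceT sL (@subsetT _ _) hn.
have fG : fin G [set 0] by exists n.
have Gdec' x : exists2 g, G g & L (x - g) by apply: Gdec.
have sM := lin_subspace_fred_part sG d; have iM := invariant_fred_part sG (j := d).
have RM := range_fred_part sG (j := d); have fM := fin_fred_part sG fG d.
have cM : closed (fred_part G d) by apply: closed_fin fM => //.
have fcM : fin_coker T (fred_part G d).
  have sTM := lin_subspace_image lT sM.
  have RdM : T @` Rg d `<=` T @` fred_part G d by apply: image_subset.
  apply: (fin_sub sM (lin_subspace_image lT (sR d)) sM sTM _ RdM) => //.
  apply: (fin_trans sM (sR d)) => //; first exact: lin_subspace_image.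
  by apply: invariant_image; apply: invariant_power.
have MV x : fred_part G d x -> V x -> Rg d x by apply: fred_part_nilpotent GL _ _ _.
exists (fred_part G d), (nil_part pi); split.
- split.
  + by [].
  + by split; [exact: lin_subspace_nil_part|exact: closed_nil_part].
  + exact: iM.
  + exact: invariant_nil_part.
  + split; apply/seteqP.
      split=> // x _; have [q Mq Vq] := fred_part_span Gdec' d x.
      have [w Rw Nw] := nil_part_complement lpi piK piid Vq.
      apply/addsetP; exists (q + w), (x - q - w); split=> //; last by lmod.
      by apply: subspaceD => //; apply: RM.
    split=> [x [Mx Nx]|_ ->].
      by apply: (nil_part_range piid); split=> //; apply: MV => //; case: Nx.
    by split; apply: subspace0 => //; apply: lin_subspace_nil_part.
- apply: (fin_sub sK lin_subspace0 _ lin_subspace0) fker => //.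
    by apply: lin_subspaceI => //; apply: lin_subspace_ker.
  move=> x [Mx Kx]; split=> //; exact: (@fred_part_nilpotent G GL d 1).
- exact: fcM.
- by apply: closed_image => //; apply: invariant_image.
- by exists d => x [Vx _].
Qed.

End Splitting.
End Decomposition.

(** * B-Fredholm operators *)

Section BFredholm.
Context {R : realType} {X : completeNormedModType R[i]}.
Implicit Types M N : set X.
Variable T : X -> X.
Hypotheses (lT : linear T) (bT : bounded_op T).
Local Notation C := R[i].
Local Notation Rg n := (power_image T n [set: X]).
Local Notation fker n := (fin_ker T (Rg n)).
Local Notation fcok n := (fin_coker T (Rg n)).

Lemma inf_nat_mem (A : set nat) n : inf_nat A = Some n -> A n.
Proof.
rewrite /inf_nat; case: pselect => // ex [<-].
by case: ex_minnP => m /asboolP.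
Qed.

Lemma inf_nat_exists (A : set nat) n : A n -> exists m, inf_nat A = Some m.
Proof.
move=> An; rewrite /inf_nat; case: pselect => [ex|[]]; first by eexists.
by exists n; apply/asboolP.
Qed.

Let iT : invariant T [set: X]. Proof. by []. Qed.
Let fker_mono m n : (m <= n)%N -> fker m -> fker n.
Proof. exact: (fin_ker_power lT lin_subspaceT). Qed.
Let fcok_mono m n : (m <= n)%N -> fcok m -> fcok n.
Proof. exact: (fin_coker_power lT lin_subspaceT). Qed.

Lemma alpha_range n : (alpha T (range_pow T n) < +oo)%E <-> fker n.
Proof. exact: dim_quo_fin. Qed.

Lemma beta_range n : (beta T (range_pow T n) < +oo)%E <-> fcok n.
Proof. exact: dim_quo_fin. Qed.

(** Finiteness of the cokernel descends from [k] to [n] as soon as the kernel is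
    finite dimensional at [n], and conversely. *)
Lemma fin_ker_coker_range j k n : fker j -> fcok k -> fker n <-> fcok n.
Proof.
move=> fj fk; split=> h.
  exact: (fin_coker_descent lT lin_subspaceT iT h fk).
exact: (fin_ker_descent lT lin_subspaceT iT h fj).
Qed.

Lemma B_Fredholm_range : B_Fredholm T -> exists p,
  [/\ fker p, fcok p, closed (Rg p) & m_ T = Some p].
Proof.
rewrite /B_Fredholm /upper_semi_B_Fredholm /lower_semi_B_Fredholm.
case Ea: (a_e T) => [n|] // [] //; case Ed: (d_e T) => [p|] // _ cp.
have /alpha_range fn := inf_nat_mem Ea; have /beta_range fp := inf_nat_mem Ed.
exists p; split=> //; first by apply/(fin_ker_coker_range p fn fp).
rewrite -Ed /m_ /d_e; congr inf_nat; apply/seteqP; split=> k /=; rewrite gt_min.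
  by move=> /orP[/alpha_range /(fin_ker_coker_range k fn fp)/beta_range|].
by move=> ->; rewrite orbT.
Qed.

(** The closedness of the range is assumed for all [n] with [fcok n], since [a_e] and
    [d_e] are only known to be among these. *)
Lemma B_Fredholm_of_range j k : fker j -> fcok k ->
  (forall n, fcok n -> closed (Rg n)) -> B_Fredholm T.
Proof.
move=> fj fk hcl; have /alpha_range aj := fj; have /beta_range bk := fk; split.
  have [n E] : exists n, a_e T = Some n.
    exact: (@inf_nat_exists [set n | (alpha T (range_pow T n) < +oo)%E] j).
  rewrite /upper_semi_B_Fredholm E; have /alpha_range := inf_nat_mem E.
  move=> /(fin_ker_coker_range n fj fk) fn; apply: hcl.
  exact: fcok_mono fn.
have [n E] : exists n, d_e T = Some n.
  exact: (@inf_nat_exists [set n | (beta T (range_pow T n) < +oo)%E] k).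
by rewrite /lower_semi_B_Fredholm E; have /beta_range := inf_nat_mem E; apply: hcl.
Qed.

Lemma RedE M N : Red T setT M N -> [/\ lin_subspace M, closed M, lin_subspace N & closed N] /\
  [/\ invariant T M, invariant T N, M `&` N `<=` [set 0] &
      forall n, Rg n = addset (power_image T n M) (power_image T n N)].
Proof.
move=> [[sM cM] [sN cN] iM iN [E MN]]; split=> //; split=> //; first by rewrite MN.
by move=> n; rewrite E -power_image_addset.
Qed.

Lemma power_image_nilpotent N k : lin_subspace N -> (forall x, N x -> iter k T x = 0) ->
  power_image T k N = [set 0].
Proof.
move=> sN nil; apply/seteqP; split=> [_ [x Nx <-]|_ ->] /=; first exact: nil.
exact: subspace0 (lin_subspace_power k lT sN).
Qed.

Lemma addset0r M : addset M [set 0] = M.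
Proof.
apply/seteqP; split=> [_ /addsetP[u [_ [Mu -> ->]]]|x Mx]; first by rewrite addr0.
by apply/addsetP; exists x, 0; rewrite addr0.
Qed.

Lemma quasi_B_Fredholm_B_Fredholm : quasi_B_Fredholm T -> B_Fredholm T.
Proof.
move=> [[M [N [/RedE[[sM cM sN cN] [iM iN MN RE]] [_ /dim_quo_fin aM] [k nil]]]]].
move=> [M' [N' [/RedE[[sM' cM' sN' cN'] [iM' iN' MN' RE']] /dim_quo_fin bM' [k' nil']]]].
have fk : fker k.
  rewrite RE (power_image_nilpotent sN nil) addset0r.
  by apply: (fin_ker_power lT sM iM (leq0n k)); rewrite power_image0.
have fk' : fcok k'.
  rewrite RE' (power_image_nilpotent sN' nil') addset0r.
  by apply: (fin_coker_power lT sM' iM' (leq0n k')); rewrite power_image0.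
apply: (B_Fredholm_of_range fk fk') => n; rewrite RE' => fn.
have sMn := lin_subspace_power n lT sM'; have sNn := lin_subspace_power n lT sN'.
have iNn : invariant T (power_image T n N') by apply: invariant_power.
have cMn : closed (power_image T n M').
  by apply: (closed_power lT bT sM' iM' _ _ (leq0n n)); rewrite power_image0.
have finN : fin (power_image T n N') [set 0].
  apply: (fin_nilpotent lT) => //.
    exists k' => _ [x Nx <-]; rewrite -iterD addnC iterD nil' //.
    exact: (lin0 (linear_iter n lT)).
  rewrite addsetC in fn; apply: fin_coker_directl fn => //.
    by apply: invariant_power.
  move=> x [[y Ny <-] [z Mz E]]; apply: MN'; split.
    by rewrite -E; apply: invariant_iter.
  exact: invariant_iter.
apply: (closed_fin _ sMn cMn); first exact: lin_subspaceD.
  exact: addsetl.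
exact: fin_addset.
Qed.

(** The same pair serves for the upper and for the lower condition. *)
Lemma B_Fredholm_splitting : B_Fredholm T -> exists M N,
  [/\ Red T setT M N, upper_semi_Fredholm T M, lower_semi_Fredholm T M & nilpotent T N].
Proof.
move=> /B_Fredholm_range[p [fp cp clp _]].
have [d pd stable] := stable_kernel lT fp.
have fd := fker_mono pd fp; have cd := fcok_mono pd cp.
have cld : closed (Rg d) by apply: (closed_power lT bT lin_subspaceT iT clp cp pd).
have [M [N [red fM cM clM nil]]] := fredholm_nilpotent_splitting lT bT fd cd cld stable.
exists M, N; split=> //; last exact/dim_quo_fin.
by split=> //; exact/dim_quo_fin.
Qed.

(** On the closed range of [T ^ p], where [T] is Fredholm, the summand of [N] has
    index 0 by [index_meromorphic]; the index of the summand of [M] has not changed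
    since [T] restricted to [M]. *)
Lemma ind_splitting p M N : fker p -> fcok p -> closed (Rg p) -> Red T setT M N ->
  semi_Fredholm T M -> meromorphic T N -> ind T M = ind T (Rg p).
Proof.
move=> fp cp clp /RedE[[sM cM sN cN] [iM iN MN RE]] semi mero.
have sMp := lin_subspace_power p lT sM; have sNp := lin_subspace_power p lT sN.
have iMp : invariant T (power_image T p M) by apply: invariant_power.
have iNp : invariant T (power_image T p N) by apply: invariant_power.
have MM : power_image T p M `<=` M by move=> _ [x Mx <-]; apply: invariant_iter.
have NN : power_image T p N `<=` N by move=> _ [x Nx <-]; apply: invariant_iter.
have MNp : power_image T p M `&` power_image T p N `<=` [set 0].
  by move=> x [/MM Mx /NN Nx]; apply: MN.
have NMp : power_image T p N `&` power_image T p M `<=` [set 0] by rewrite setIC.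
have fp' := fp; have cp' := cp; rewrite RE in fp' cp'.
have fkM : fin_ker T (power_image T p M) by apply: fin_ker_directl fp'.
have fcM : fin_coker T (power_image T p M) by apply: fin_coker_directl cp'.
rewrite addsetC in fp' cp'.
have fkN : fin_ker T (power_image T p N) by apply: fin_ker_directl fp'.
have fcN : fin_coker T (power_image T p N) by apply: fin_coker_directl cp'.
have [fkM0 fcM0] : fin_ker T M /\ fin_coker T M.
  case: semi => [[_ /dim_quo_fin fM]|/dim_quo_fin fM]; split=> //.
    by rewrite -(power_image0 T M); apply: fin_coker_descent fcM => //; rewrite power_image0.
  by rewrite -(power_image0 T M); apply: fin_ker_descent fkM => //; rewrite power_image0.
have [a [b hab]] := has_indexP fkM0 fcM0.
have [a' [b' [hab' E]]] := has_index_power lT sM iM p hab.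
have [c [e hce]] := has_indexP fkN fcN.
have ce : c = e.
  apply: (index_meromorphic lT bT sNp _ iNp hce).
    rewrite (_ : power_image T p N = Rg p `&` N); first exact: closedI.
    apply/seteqP; split=> x.
      by move=> Nx; split; [rewrite RE; apply: addsetr|apply: NN].
    rewrite RE => -[/addsetP[u [v [Mu Nv xE]]] Nx].
    have E' : 0 + x = u + v by rewrite add0r.
    by have [_ ->] := direct_eq sM sN MN (subspace0 sM) (MM _ Mu) Nx (NN _ Nv) E'.
  move=> l l0 A; have [P [Q [[[sP _] [sQ _] iP iQ [NE PQ]] inv nil]]] := mero l l0.
  have [g [_ gP gl gr]] := inv.
  have lA : linear A by apply: linear_shift.
  have invT Y : lin_subspace Y -> invariant A Y -> invariant T Y.
    move=> sY iY x Yx; rewrite -(subrK (l *: x) (T x)).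
    by apply: subspaceD => //; [exact: iY|exact: subspaceZ].
  have comm x : A (iter p T x) = iter p T (A x).
    rewrite (linB _ _ (linear_iter p lT)) (linZ _ _ (linear_iter p lT)).
    by rewrite /A -iterS iterSr.
  have iA Y : invariant A Y -> invariant A (power_image T p Y).
    by move=> iY _ [x Yx <-]; rewrite comm; exists (A x) => //; apply: iY.
  have subP : power_image T p P `<=` P.
    by move=> _ [x Px <-]; apply: invariant_iter => //; apply: invT.
  have subQ : power_image T p Q `<=` Q.
    by move=> _ [x Qx <-]; apply: invariant_iter => //; apply: invT.
  exists (power_image T p P), (power_image T p Q); split.
    by split; [exact: lin_subspace_power|exact: lin_subspace_power|exact: iA|exact: iA].
  split.
  - by rewrite NE -power_image_addset.
  - by move=> x [/subP Px /subQ Qx]; rewrite -PQ.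
  - apply/seteqP; split; first by apply: invariant_image; apply: iA.
    move=> _ [x Px <-]; exists (iter p T (g x)); first by exists (g x) => //; apply: gP.
    by rewrite comm /A gr.
  - move=> x [/subP Px Ax] /=; rewrite -(gl x Px) (Ax : T x - l *: x = 0).
    by have := gl 0 (subspace0 sP); rewrite (lin0 lT) scaler0 subr0.
  - by have [k hk] := nil; exists k => x /subQ; apply: hk.
have hR := has_index_direct lT sMp sNp iMp iNp MNp hab' hce.
rewrite -RE in hR.
rewrite (indE lT sM hab) (indE lT (lin_subspace_power p lT lin_subspaceT) hR) ce.
congr (_%:E); lia.
Qed.

Lemma nilpotent_meromorphic N : lin_subspace N -> closed N -> invariant T N ->
  continuous T -> nilpotent T N -> meromorphic T N.
Proof.
move=> sN cN iN cT [k nil] l l0.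
(* Partial sums of the geometric series of [(T - l)^-1 = - l^-1 (1 - T / l)^-1]. *)
pose g j (x : X) : X := iter j (fun y => - l^-1 *: (x - T y)) 0.
have cg j : continuous (g j).
  elim: j => [|j IH] x; first exact: cvg_cst.
  apply: cvgZr; apply: cvgB; first exact: cvg_id.
  exact: (continuous_comp (IH x) (cT _)).
have gN j x : N x -> N (g j x).
  move=> Nx; elim: j => [|j IH] /=; first exact: subspace0.
  by apply: subspaceZ => //; apply: subspaceB => //; apply: iN.
have gE j x : T (g j x) - l *: g j x = x - (l^-1) ^+ j *: iter j T x.
  elim: j x => [|j IH] x; first by rewrite /= (lin0 lT) scaler0 subr0 expr0 scale1r subrr.
  have -> : T (g j.+1 x) - l *: g j.+1 x = x - l^-1 *: (T x) + l^-1 *: T (T (g j x) - l *: g j x).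
    by rewrite /= !(linZ _ _ lT) !(linB _ _ lT) (linZ _ _ lT); lmod_field.
  rewrite IH (linB _ _ lT) (linZ _ _ lT) exprS /=.
  by lmod.
have gC j x : g j (T x - l *: x) = T (g j x) - l *: g j x.
  elim: j => [|j IH] /=; first by rewrite (lin0 lT) scaler0 subrr.
  rewrite IH !(linZ _ _ lT) !(linB _ _ lT) (linZ _ _ lT); lmod.
exists N, [set 0]; split.
- split=> //.
  + by split; [exact: lin_subspace0|exact: closed_set0].
  + by move=> x Nx; apply: subspaceB => //; [apply: iN|apply: subspaceZ].
  + by move=> _ ->; rewrite /= (lin0 lT) scaler0 subrr.
  + split; first by rewrite -[LHS]addset0r.
    by apply/seteqP; split=> [x []|_ ->] //; split=> //; apply: subspace0.
- exists (g k); split.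
  + exact/continuous_subspaceT/cg.
  + by move=> x; apply: gN.
  + by move=> x Nx; rewrite gC gE nil // scaler0 subr0.
  + by move=> x Nx; rewrite gE nil // scaler0 subr0.
- by exists 0%N.
Qed.

End BFredholm.

Theorem corollary2p16 (R : realType) (X : completeNormedModType R[i])
  (infX : infinite_dimensional X) (T : {linear X -> X}) (contT : continuous T) :
  (quasi_B_Fredholm T <-> B_Fredholm T) /\
  (B_Fredholm T -> generalized_index T = B_Fredholm_index T).
Proof.
have lT : linear T := linearP T.
have bT : bounded_op T := continuous_bounded_op contT.
split; first split.
- exact: quasi_B_Fredholm_B_Fredholm.
- by move=> /(B_Fredholm_splitting lT bT)[M [N [red up low nil]]]; split; exists M, N.
move=> BF; have [p [fp cp clp mp]] := B_Fredholm_range lT BF.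
rewrite /B_Fredholm_index mp; apply: xget_unique.
  have [M [N [red up low nil]]] := B_Fredholm_splitting lT bT BF.
  have [[sM cM sN cN] [iM iN _ _]] := RedE lT red.
  have mero : meromorphic T N by apply: nilpotent_meromorphic.
  exists M, N; split=> //; first by left.
  by rewrite (ind_splitting lT bT fp cp clp red) //; left.
move=> _ [M [N [red semi mero ->]]].
exact: (ind_splitting lT bT fp cp clp red).
Qed.
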